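(* Let $A$ be a finite dimensional Frobenius algebra over a field $k$. For all $A$-bimodules $M,N$ and all $r,s\in\mathbb Z$, the cup product $$\smile:\widehat{\mathrm H}^{r}(A,M)\otimes\widehat{\mathrm H}^{s}(A,N)\to\widehat{\mathrm H}^{r+s}(A,M\otimes_AN)$$ does not depend on the choice of a complete resolution $\mathbf T$ of $A$ and of a diagonal approximation $\widehat\Delta:\mathbf T\to\mathbf T\widehat\otimes_A\mathbf T$ used to define it (Tate-Hochschild cohomology groups computed from different complete resolutions being identified canonically).
   Context: A finite dimensional $k$-algebra $A$ is Frobenius if there is a non-degenerate bilinear form $\langle-,-\rangle:A\otimes_kA\to k$ with $\langle ab,c\rangle=\langle a,bc\rangle$. $A$-bimodules are modules over $A^{\mathrm e}=A\otimes_kA^{\mathrm{op}}$. A complete resolution $\mathbf T\xrightarrow{\varepsilon}A$ is an acyclic chain complex $\mathbf T=(T_i,d_i)_{i\in\mathbb Z}$ of finitely generated projective $A$-bimodules together with a factorization $d_0=\eta\varepsilon$, where $\varepsilon:T_0\to A$ is a surjective and $\eta:A\to T_{-1}$ an injective bimodule map; $\varepsilon$, extended by $0$, is the augmentation. Between any two complete resolutions of $A$ there is an augmentation-preserving chain map, unique up to homotopy, and it is a homotopy equivalence. $\widehat{\mathrm H}^n(A,M)$ is the $n$-th cohomology of the complex with $\mathrm{Hom}_{A^{\mathrm e}}(T_n,M)$ in degree $n$ and differential $f\mapsto-(-1)^nfd_{n+1}$; groups computed from different $\mathbf T$ are identified via augmentation-preserving chain maps. The complete tensor product $\mathbf T\widehat\otimes_A\mathbf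 T$ has components $\prod_{i\in\mathbb Z}T_{n-i}\otimes_AT_i$ and differential $x\otimes y\mapsto d(x)\otimes y+(-1)^{|x|}x\otimes d(y)$. A diagonal approximation is a chain map of bimodule complexes $\widehat\Delta:\mathbf T\to\mathbf T\widehat\otimes_A\mathbf T$ with $(\varepsilon\widehat\otimes_A\varepsilon)\widehat\Delta=\varepsilon$. For cochains $u:T_r\to M$ and $v:T_s\to N$, $u\smile v=(u\widehat\otimes_Av)\widehat\Delta:T_{r+s}\to M\otimes_AN$, i.e. project $\widehat\Delta$ to $T_r\otimes_AT_s$ and apply $x\otimes y\mapsto(-1)^{rs}u(x)\otimes v(y)$; this induces the cup product on cohomology. *)

(* Defs.v *)
From HB Require Import structures.
From mathcomp Require Import all_boot all_order all_algebra falgebra.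
From mathcomp Require Import boolp.

Set Implicit Arguments.
Unset Strict Implicit.
Unset Printing Implicit Defensive.

Import GRing.Theory.
Local Open Scope ring_scope.
Local Open Scope quotient_scope.

Definition Frobenius (k : fieldType) (A : falgType k) : Prop :=
  exists B : A -> A -> k^o,
    [/\ (forall a, linear (B a)) /\ (forall b, linear (B^~ b)),
        (forall a, (forall b, B a b = 0) -> a = 0)
          /\ (forall b, (forall a, B a b = 0) -> b = 0) &
        forall a b c, B (a * b) c = B a (b * c)].

(* Linearity of both actions in the algebra argument forces c%:A to act on
   either side as the scalar c, so these are exactly the modules over
   A (x)_k A^op. *)
Record bimodule (k : fieldType) (A : falgType k) := Bimodule {
  bimod_sort :> lmodType k;
  lact : A -> bimod_sort -> bimod_sort;
  ract : bimod_sort -> A -> bimod_sort;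
  lact_linearl : forall x, linear (lact^~ x);
  lact_linearr : forall a, linear (lact a);
  ract_linearl : forall a, linear (ract^~ a);
  ract_linearr : forall x, linear (ract x);
  lact1 : forall x, lact 1 x = x;
  lactM : forall a b x, lact (a * b) x = lact a (lact b x);
  ract1 : forall x, ract x 1 = x;
  ractM : forall x a b, ract x (a * b) = ract (ract x a) b;
  lractA : forall a x b, ract (lact a x) b = lact a (ract x b)
}.

Lemma lin_add (k : fieldType) (U V : lmodType k) (f : U -> V) :
  linear f -> {morph f : x y / x + y}.
Proof. by move=> fL x y; have := fL 1 x y; rewrite !scale1r. Qed.

Lemma lin_scale (k : fieldType) (U V : lmodType k) (f : U -> V) :
  linear f -> forall c x, f (c *: x) = c *: f x.
Proof.
move=> fL c x.
have f0 : f 0 = 0.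
  by apply: (addrI (f 0)); rewrite -(lin_add fL) !addr0.
by have := fL c x 0; rewrite !addr0 f0 addr0.
Qed.

Section BimoduleTheory.
Variables (k : fieldType) (A : falgType k) (M : bimodule A).
Implicit Types (a b : A) (x y : M).

Lemma lactDl a b x : lact (a + b) x = lact a x + lact b x.
Proof. exact: (lin_add (lact_linearl x)). Qed.
Lemma lactDr a x y : lact a (x + y) = lact a x + lact a y.
Proof. exact: (lin_add (lact_linearr a)). Qed.
Lemma lactZl c a x : lact (c *: a) x = c *: lact a x.
Proof. exact: (lin_scale (lact_linearl x)). Qed.
Lemma lactZr c a x : lact a (c *: x) = c *: lact a x.
Proof. exact: (lin_scale (lact_linearr a)). Qed.
Lemma ractDl x y a : ract (x + y) a = ract x a + ract y a.
Proof. exact: (lin_add (ract_linearl a)). Qed.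
Lemma ractDr x a b : ract x (a + b) = ract x a + ract x b.
Proof. exact: (lin_add (ract_linearr x)). Qed.
Lemma ractZl c x a : ract (c *: x) a = c *: ract x a.
Proof. exact: (lin_scale (ract_linearl a)). Qed.
Lemma ractZr c x a : ract x (c *: a) = c *: ract x a.
Proof. exact: (lin_scale (ract_linearr x)). Qed.

Lemma lact_scalar c x : lact c%:A x = c *: x.
Proof. by rewrite lactZl lact1. Qed.
Lemma ract_scalar c x : ract x c%:A = c *: x.
Proof. by rewrite ractZr ract1. Qed.

End BimoduleTheory.

Section RegularBimodule.
Variables (k : fieldType) (A : falgType k).

Fact reg_linearl (x : A) : linear (fun a : A => a * x).
Proof. by move=> c a b; rewrite mulrDl scalerAl. Qed.
Fact reg_linearr (x : A) : linear (fun a : A => x * a).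
Proof. by move=> c a b; rewrite mulrDr scalerAr. Qed.
Fact reg_mulA (a b x : A) : a * b * x = a * (b * x).
Proof. by rewrite mulrA. Qed.

Definition regular_bimodule : bimodule A :=
  @Bimodule k A A (fun a x => a * x) (fun x a => x * a)
    reg_linearl reg_linearr reg_linearl reg_linearr
    (@mul1r A) reg_mulA (@mulr1 A) (@mulrA A) reg_mulA.

End RegularBimodule.

Record bimod_hom (k : fieldType) (A : falgType k) (M N : bimodule A) :=
  BimodHom {
    hom_fun :> M -> N;
    hom_linear : linear hom_fun;
    hom_lact : forall a x, hom_fun (lact a x) = lact a (hom_fun x);
    hom_ract : forall x a, hom_fun (ract x a) = ract (hom_fun x) a
  }.

Section HomTheory.
Variables (k : fieldType) (A : falgType k).
Implicit Types (M N P : bimodule A).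

Lemma hom_ext M N (f g : bimod_hom M N) : f =1 g -> f = g.
Proof.
case: f g => [f fL fl fr] [g gL gl gr] /= /funext fg.
by subst g; congr BimodHom; apply: Prop_irrelevance.
Qed.

Lemma homD M N (f : bimod_hom M N) x y : f (x + y) = f x + f y.
Proof. exact: (lin_add (hom_linear f)). Qed.
Lemma homZ M N (f : bimod_hom M N) c x : f (c *: x) = c *: f x.
Proof. exact: (lin_scale (hom_linear f)). Qed.
Lemma hom0 M N (f : bimod_hom M N) : f 0 = 0.
Proof. by rewrite -(scale0r 0) homZ scale0r. Qed.
Lemma homN M N (f : bimod_hom M N) x : f (- x) = - f x.
Proof. by rewrite -scaleN1r homZ scaleN1r. Qed.

Fact hom_comp_linear M N P (g : bimod_hom N P) (f : bimod_hom M N) :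
  linear (fun x => g (f x)).
Proof. by move=> c x y; rewrite !homD !homZ. Qed.
Fact hom_comp_lact M N P (g : bimod_hom N P) (f : bimod_hom M N) a x :
  g (f (lact a x)) = lact a (g (f x)).
Proof. by rewrite !hom_lact. Qed.
Fact hom_comp_ract M N P (g : bimod_hom N P) (f : bimod_hom M N) x a :
  g (f (ract x a)) = ract (g (f x)) a.
Proof. by rewrite !hom_ract. Qed.
Definition hom_comp M N P (g : bimod_hom N P) (f : bimod_hom M N) : bimod_hom M P :=
  @BimodHom k A M P (fun x => g (f x))
    (hom_comp_linear g f) (hom_comp_lact g f) (hom_comp_ract g f).

Fact hom_zero_linear M N :
  linear (fun _ : M => 0 : N).
Proof. by move=> c x y; rewrite scaler0 addr0. Qed.
Fact hom_zero_lact M N a (x : M) : (0 : N) = lact a 0.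
Proof. by rewrite -[0 in RHS](scale0r (0 : N)) lactZr scale0r. Qed.
Fact hom_zero_ract M N (x : M) a : (0 : N) = ract 0 a.
Proof. by rewrite -[0 in RHS](scale0r (0 : N)) ractZl scale0r. Qed.
Definition hom_zero M N : bimod_hom M N :=
  @BimodHom k A M N (fun=> 0)
    (@hom_zero_linear M N) (@hom_zero_lact M N) (@hom_zero_ract M N).

Fact hom_add_linear M N (f g : bimod_hom M N) :
  linear (fun x => f x + g x).
Proof. by move=> c x y; rewrite !homD !homZ scalerDr addrACA. Qed.
Fact hom_add_lact M N (f g : bimod_hom M N) a x :
  f (lact a x) + g (lact a x) = lact a (f x + g x).
Proof. by rewrite !hom_lact lactDr. Qed.
Fact hom_add_ract M N (f g : bimod_hom M N) x a :
  f (ract x a) + g (ract x a) = ract (f x + g x) a.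
Proof. by rewrite !hom_ract ractDl. Qed.
Definition hom_add M N (f g : bimod_hom M N) : bimod_hom M N :=
  @BimodHom k A M N (fun x => f x + g x)
    (hom_add_linear f g) (hom_add_lact f g) (hom_add_ract f g).

Fact hom_scale_linear M N (c : k) (f : bimod_hom M N) :
  linear (fun x => c *: f x).
Proof. by move=> e x y; rewrite homD homZ scalerDr !scalerA mulrC. Qed.
Fact hom_scale_lact M N (c : k) (f : bimod_hom M N) a x :
  c *: f (lact a x) = lact a (c *: f x).
Proof. by rewrite !hom_lact lactZr. Qed.
Fact hom_scale_ract M N (c : k) (f : bimod_hom M N) x a :
  c *: f (ract x a) = ract (c *: f x) a.
Proof. by rewrite !hom_ract ractZl. Qed.
Definition hom_scale M N (c : k) (f : bimod_hom M N) : bimod_hom M N :=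
  @BimodHom k A M N (fun x => c *: f x)
    (hom_scale_linear c f) (hom_scale_lact c f) (hom_scale_ract c f).

Section HomSpace.
Variables M N : bimodule A.

HB.instance Definition _ := gen_eqMixin (bimod_hom M N).
HB.instance Definition _ := gen_choiceMixin (bimod_hom M N).

Fact hom_addA : associative (@hom_add M N).
Proof. by move=> f g h; apply: hom_ext => x /=; rewrite addrA. Qed.
Fact hom_addC : commutative (@hom_add M N).
Proof. by move=> f g; apply: hom_ext => x /=; rewrite addrC. Qed.
Fact hom_add0 : left_id (hom_zero M N) (@hom_add M N).
Proof. by move=> f; apply: hom_ext => x /=; rewrite add0r. Qed.
Fact hom_addN :
  left_inverse (hom_zero M N) (@hom_scale M N (-1)) (@hom_add M N).
Proof. by move=> f; apply: hom_ext => x /=; rewrite scaleN1r addNr. Qed.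

HB.instance Definition _ := GRing.isZmodule.Build (bimod_hom M N)
  hom_addA hom_addC hom_add0 hom_addN.

Fact hom_scaleA (a b : k) (f : bimod_hom M N) :
  hom_scale a (hom_scale b f) = hom_scale (a * b) f.
Proof. by apply: hom_ext => x /=; rewrite scalerA. Qed.
Fact hom_scale1 : left_id 1 (@hom_scale M N).
Proof. by move=> f; apply: hom_ext => x /=; rewrite scale1r. Qed.
Fact hom_scaleDr : right_distributive (@hom_scale M N) +%R.
Proof. by move=> a f g; apply: hom_ext => x /=; rewrite scalerDr. Qed.
Fact hom_scaleDl (f : bimod_hom M N) :
  {morph (@hom_scale M N)^~ f : a b / a + b}.
Proof. by move=> a b; apply: hom_ext => x /=; rewrite scalerDl. Qed.

HB.instance Definition _ := GRing.Zmodule_isLmodule.Build k (bimod_hom M N)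
  hom_scaleA hom_scale1 hom_scaleDr hom_scaleDl.

Lemma homDE (f g : bimod_hom M N) x : (f + g) x = f x + g x.
Proof. by []. Qed.
Lemma homZE c (f : bimod_hom M N) x : (c *: f) x = c *: f x.
Proof. by []. Qed.
Lemma hom0E x : (0 : bimod_hom M N) x = 0.
Proof. by []. Qed.

End HomSpace.
End HomTheory.

Definition finitely_generated (k : fieldType) (A : falgType k)
    (P : bimodule A) : Prop :=
  exists (n : nat) (g : 'I_n -> P), forall x : P,
    exists t : seq (A * 'I_n * A),
      x = \sum_(s <- t) ract (lact s.1.1 (g s.1.2)) s.2.

Definition projective (k : fieldType) (A : falgType k)
    (P : bimodule A) : Prop :=
  forall (X Y : bimodule A) (p : bimod_hom X Y) (f : bimod_hom P Y),
    (forall y, exists x, p x = y) ->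
    exists h : bimod_hom P X, hom_comp p h = f.

(* M (x)_A N is the quotient of the finite formal sums of symbols x (x) y,
   represented by lists of pairs, by the congruence generated by
   commutativity of formal addition, biadditivity and A-balancedness. *)
Section Tensor.
Variables (k : fieldType) (A : falgType k) (M N : bimodule A).

Inductive tens_rel : seq (M * N) -> seq (M * N) -> Prop :=
| TensRefl s : tens_rel s s
| TensSym s t : tens_rel s t -> tens_rel t s
| TensTrans s t u : tens_rel s t -> tens_rel t u -> tens_rel s u
| TensCat s s' t t' :
    tens_rel s s' -> tens_rel t t' -> tens_rel (s ++ t) (s' ++ t')
| TensComm s t : tens_rel (s ++ t) (t ++ s)
| TensDl x x' y : tens_rel [:: (x + x', y)] [:: (x, y); (x', y)]
| TensDr x y y' : tens_rel [:: (x, y + y')] [:: (x, y); (x, y')]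
| Tens0 y : tens_rel [:: (0, y)] [::]
| TensBal x a y : tens_rel [:: (ract x a, y)] [:: (x, lact a y)].

Definition tens_relb (s t : seq (M * N)) : bool := `[< tens_rel s t >].

Fact tens_relb_refl : reflexive tens_relb.
Proof. by move=> s; apply/asboolP/TensRefl. Qed.
Fact tens_relb_sym : symmetric tens_relb.
Proof. by move=> s t; apply/asboolP/asboolP => /TensSym. Qed.
Fact tens_relb_trans : transitive tens_relb.
Proof.
by move=> t s u /asboolP st /asboolP tu; apply/asboolP/(TensTrans st tu).
Qed.

Canonical tens_equiv :=
  EquivRel tens_relb tens_relb_refl tens_relb_sym tens_relb_trans.

Definition tens_type := {eq_quot tens_relb}.
HB.instance Definition _ : EqQuotient _ tens_equiv tens_type :=
  EqQuotient.on tens_type.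
HB.instance Definition _ := Choice.on tens_type.

Definition tens_class (s : seq (M * N)) : tens_type := \pi_tens_type s.

Lemma tens_classP s t : tens_rel s t -> tens_class s = tens_class t.
Proof. by move=> st; apply/eqquotP/asboolP. Qed.

Lemma tens_class_inj s t : tens_class s = tens_class t -> tens_rel s t.
Proof. by move/eqquotP/asboolP. Qed.

Lemma tens_classK (z : tens_type) : tens_class (repr z) = z.
Proof. exact: reprK. Qed.

Lemma tens_reprP s : tens_rel (repr (tens_class s)) s.
Proof. by apply: tens_class_inj; rewrite tens_classK. Qed.

Definition sscale (c : k) (s : seq (M * N)) : seq (M * N) :=
  [seq (c *: p.1, p.2) | p <- s].

Fact sscale_rel c s t : tens_rel s t -> tens_rel (sscale c s) (sscale c t).
Proof.
elim=> {s t}.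
- by move=> s; apply: TensRefl.
- by move=> s t _; apply: TensSym.
- by move=> s t u _ + _; apply: TensTrans.
- by move=> s s' t t' _ Hs _ Ht; rewrite /sscale !map_cat; apply: TensCat.
- by move=> s t; rewrite /sscale !map_cat; apply: TensComm.
- by move=> x x' y; rewrite /sscale /= scalerDr; apply: TensDl.
- by move=> x y y'; apply: TensDr.
- by move=> y; rewrite /sscale /= scaler0; apply: Tens0.
- by move=> x a y; rewrite /sscale /= -ractZl; apply: TensBal.
Qed.

Definition tens_add (z w : tens_type) := tens_class (repr z ++ repr w).
Definition tens_scale c (z : tens_type) := tens_class (sscale c (repr z)).

Fact tens_addE s t : tens_add (tens_class s) (tens_class t) = tens_class (s ++ t).
Proof. by apply/tens_classP/TensCat; apply: tens_reprP. Qed.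
Fact tens_scaleE c s : tens_scale c (tens_class s) = tens_class (sscale c s).
Proof. by apply/tens_classP/sscale_rel/tens_reprP. Qed.

Fact tens_ind_class (P : tens_type -> Prop) :
  (forall s, P (tens_class s)) -> forall z, P z.
Proof. by move=> H z; rewrite -(tens_classK z). Qed.

Fact tens_addA : associative tens_add.
Proof.
elim/tens_ind_class=> s; elim/tens_ind_class=> t; elim/tens_ind_class=> u.
by rewrite !tens_addE catA.
Qed.
Fact tens_addC : commutative tens_add.
Proof.
elim/tens_ind_class=> s; elim/tens_ind_class=> t.
by rewrite !tens_addE; apply/tens_classP/TensComm.
Qed.
Fact tens_add0 : left_id (tens_class [::]) tens_add.
Proof. by elim/tens_ind_class=> s; rewrite tens_addE. Qed.
Fact tens_scaleDl z : {morph tens_scale^~ z : a b / a + b >-> tens_add a b}.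
Proof.
elim/tens_ind_class: z => s a b; rewrite !tens_scaleE tens_addE.
apply/tens_classP; elim: s => [|[x y] s IHs]; first exact: TensRefl.
have E1 := TensCat (TensDl (a *: x) (b *: x) y) IHs.
rewrite -scalerDl in E1; apply: (TensTrans E1).
apply: (@TensCat [:: (a *: x, y)] [:: (a *: x, y)]
  (([:: (b *: x, y)] ++ sscale a s) ++ sscale b s)
  (sscale a s ++ [:: (b *: x, y)] ++ sscale b s)); first exact: TensRefl.
rewrite catA; apply: TensCat; last exact: TensRefl.
exact: TensComm.
Qed.
Fact tens_scale0 z : tens_scale 0 z = tens_class [::].
Proof.
elim/tens_ind_class: z => s; rewrite tens_scaleE; apply/tens_classP.
elim: s => [|[x y] s IHs]; first exact: TensRefl.
rewrite /sscale /= -/(sscale _ _) scale0r -cat1s -[[::]]/([::] ++ [::]).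
by apply: TensCat; first exact: Tens0.
Qed.
Fact tens_scale1 : left_id 1 tens_scale.
Proof.
elim/tens_ind_class=> s; rewrite tens_scaleE /sscale; congr tens_class.
by rewrite -[RHS]map_id; apply: eq_map => -[x y] /=; rewrite scale1r.
Qed.
Fact tens_addN : left_inverse (tens_class [::]) (tens_scale (-1)) tens_add.
Proof.
by move=> z; rewrite -{2}[z]tens_scale1 -tens_scaleDl addNr tens_scale0.
Qed.

HB.instance Definition _ := GRing.isZmodule.Build tens_type
  tens_addA tens_addC tens_add0 tens_addN.

Lemma tens_classD s t : tens_class s + tens_class t = tens_class (s ++ t).
Proof. exact: tens_addE. Qed.

Fact tens_scaleA a b z : tens_scale a (tens_scale b z) = tens_scale (a * b) z.
Proof.
elim/tens_ind_class: z => s; rewrite !tens_scaleE /sscale -map_comp.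
by congr tens_class; apply: eq_map => -[x y] /=; rewrite scalerA.
Qed.
Fact tens_scaleDr : right_distributive tens_scale +%R.
Proof.
move=> a; elim/tens_ind_class=> s; elim/tens_ind_class=> t.
by rewrite tens_classD !tens_scaleE tens_classD /sscale map_cat.
Qed.

HB.instance Definition _ := GRing.Zmodule_isLmodule.Build k tens_type
  tens_scaleA tens_scale1 tens_scaleDr tens_scaleDl.

Lemma tens_classZ c s : c *: tens_class s = tens_class (sscale c s).
Proof. exact: tens_scaleE. Qed.

Definition tens (x : M) (y : N) : tens_type := tens_class [:: (x, y)].

Lemma tens_classE s : tens_class s = \sum_(p <- s) tens p.1 p.2.
Proof.
elim: s => [|[x y] s IHs]; first by rewrite big_nil.
by rewrite big_cons -IHs tens_classD.
Qed.

Lemma tens_sum (z : tens_type) : z = \sum_(p <- repr z) tens p.1 p.2.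
Proof. by rewrite -tens_classE tens_classK. Qed.

Lemma tensDl x x' y : tens (x + x') y = tens x y + tens x' y.
Proof. by rewrite tens_classD; apply/tens_classP/TensDl. Qed.
Lemma tensDr x y y' : tens x (y + y') = tens x y + tens x y'.
Proof. by rewrite tens_classD; apply/tens_classP/TensDr. Qed.
Lemma tensZl c x y : tens (c *: x) y = c *: tens x y.
Proof. by rewrite tens_classZ. Qed.
Lemma tens_bal x a y : tens (ract x a) y = tens x (lact a y).
Proof. exact/tens_classP/TensBal. Qed.
Lemma tensZr c x y : tens x (c *: y) = c *: tens x y.
Proof. by rewrite -lact_scalar -tens_bal ract_scalar tensZl. Qed.

Definition balanced (V : zmodType) (phi : M -> N -> V) : Prop :=
  [/\ forall x x' y, phi (x + x') y = phi x y + phi x' y,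
      forall x y y', phi x (y + y') = phi x y + phi x y' &
      forall x a y, phi (ract x a) y = phi x (lact a y)].

(* The additive map on M (x)_A N induced by a balanced map phi. *)
Definition tens_lift (V : zmodType) (phi : M -> N -> V) (z : tens_type) : V :=
  \sum_(p <- repr z) phi p.1 p.2.

Lemma tens_lift_class (V : zmodType) (phi : M -> N -> V) s :
  balanced phi -> tens_lift phi (tens_class s) = \sum_(p <- s) phi p.1 p.2.
Proof.
case=> phiDl phiDr phiB; rewrite /tens_lift.
have := tens_reprP s; move: (repr _) => t; elim=> {s t} //.
- by move=> s t u _ -> _ ->.
- by move=> s s' t t' _ Hs _ Ht; rewrite !big_cat Hs Ht.
- by move=> s t; rewrite !big_cat /= addrC.
- by move=> x x' y; rewrite !big_cons !big_nil !addr0 phiDl.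
- by move=> x y y'; rewrite !big_cons !big_nil !addr0 phiDr.
- move=> y; rewrite big_seq1 big_nil /=.
  by apply: (addrI (phi 0 y)); rewrite -phiDl !addr0.
- by move=> x a y; rewrite !big_seq1 phiB.
Qed.

Lemma tens_liftE (V : zmodType) (phi : M -> N -> V) x y :
  balanced phi -> tens_lift phi (tens x y) = phi x y.
Proof. by move=> phiP; rewrite tens_lift_class // big_seq1. Qed.

Lemma tens_liftD (V : zmodType) (phi : M -> N -> V) z w :
  balanced phi -> tens_lift phi (z + w) = tens_lift phi z + tens_lift phi w.
Proof.
move=> phiP; elim/tens_ind_class: z => s; elim/tens_ind_class: w => t.
by rewrite tens_classD !tens_lift_class // big_cat.
Qed.

Lemma tens_liftZ (V : lmodType k) (phi : M -> N -> V) c z :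
  balanced phi -> (forall x y, phi (c *: x) y = c *: phi x y) ->
  tens_lift phi (c *: z) = c *: tens_lift phi z.
Proof.
move=> phiP phiZ; elim/tens_ind_class: z => s.
rewrite tens_classZ !tens_lift_class // big_map scaler_sumr.
by apply: eq_bigr => p _; rewrite phiZ.
Qed.

Lemma tens_eq (V : zmodType) (f g : tens_type -> V) :
  {morph f : z w / z + w} -> {morph g : z w / z + w} ->
  (forall x y, f (tens x y) = g (tens x y)) -> f =1 g.
Proof.
move=> fD gD fg z; rewrite (tens_sum z).
have f0 : f 0 = 0 by apply: (addrI (f 0)); rewrite -fD !addr0.
have g0 : g 0 = 0 by apply: (addrI (g 0)); rewrite -gD !addr0.
elim: (repr z : seq _) => [|p s IHs]; first by rewrite big_nil f0 g0.
by rewrite big_cons fD gD fg IHs.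
Qed.

Definition tens_lact a : tens_type -> tens_type :=
  tens_lift (fun x y => tens (lact a x) y).
Definition tens_ract (z : tens_type) a : tens_type :=
  tens_lift (fun x y => tens x (ract y a)) z.

Fact tens_lact_bal a : balanced (fun x y => tens (lact a x) y).
Proof.
split=> [x x' y|x y y'|x b y]; first by rewrite lactDr tensDl.
  by rewrite tensDr.
by rewrite -lractA tens_bal.
Qed.
Fact tens_ract_bal a : balanced (fun x y => tens x (ract y a)).
Proof.
split=> [x x' y|x y y'|x b y]; first by rewrite tensDl.
  by rewrite ractDl tensDr.
by rewrite tens_bal lractA.
Qed.

Lemma tens_lactE a x y : tens_lact a (tens x y) = tens (lact a x) y.
Proof. exact/tens_liftE/tens_lact_bal. Qed.
Lemma tens_ractE a x y : tens_ract (tens x y) a = tens x (ract y a).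
Proof. exact/(@tens_liftE _ (fun x y => _))/tens_ract_bal. Qed.
Lemma tens_lactD a : {morph tens_lact a : z w / z + w}.
Proof. by move=> z w; apply/tens_liftD/tens_lact_bal. Qed.
Lemma tens_ractD a : {morph tens_ract^~ a : z w / z + w}.
Proof. by move=> z w; apply/tens_liftD/tens_ract_bal. Qed.
Lemma tens_lactZ a c z : tens_lact a (c *: z) = c *: tens_lact a z.
Proof.
apply: tens_liftZ => [|x y]; first exact: tens_lact_bal.
by rewrite lactZr tensZl.
Qed.
Lemma tens_ractZ a c z : tens_ract (c *: z) a = c *: tens_ract z a.
Proof.
apply: tens_liftZ => [|x y]; first exact: tens_ract_bal.
by rewrite tensZl.
Qed.

Fact tens_lact_linearl z : linear (tens_lact^~ z).
Proof.
move=> c a b; move: z; apply: (@tens_eq _ (tens_lact (c *: a + b))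
  (fun z => c *: tens_lact a z + tens_lact b z)).
- exact: tens_lactD.
- by move=> u v; rewrite !tens_lactD scalerDr addrACA.
- by move=> x y; rewrite !tens_lactE lactDl lactZl tensDl tensZl.
Qed.
Fact tens_lact_linearr a : linear (tens_lact a).
Proof. by move=> c z w; rewrite tens_lactD tens_lactZ. Qed.
Fact tens_ract_linearl a : linear (tens_ract^~ a).
Proof. by move=> c z w; rewrite tens_ractD tens_ractZ. Qed.
Fact tens_ract_linearr z : linear (tens_ract z).
Proof.
move=> c a b; move: z; apply: (@tens_eq _ (tens_ract^~ (c *: a + b))
  (fun z => c *: tens_ract z a + tens_ract z b)).
- exact: tens_ractD.
- by move=> u v; rewrite !tens_ractD scalerDr addrACA.
- by move=> x y; rewrite !tens_ractE ractDr ractZr tensDr tensZr.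
Qed.
Fact tens_lact1 z : tens_lact 1 z = z.
Proof.
move: z; apply: (@tens_eq _ (tens_lact 1) id) => //; first exact: tens_lactD.
by move=> x y; rewrite tens_lactE lact1.
Qed.
Fact tens_lactM a b z : tens_lact (a * b) z = tens_lact a (tens_lact b z).
Proof.
move: z; apply: (@tens_eq _ _ (fun z => tens_lact a (tens_lact b z))).
- exact: tens_lactD.
- by move=> u v; rewrite !tens_lactD.
- by move=> x y; rewrite !tens_lactE lactM.
Qed.
Fact tens_ract1 z : tens_ract z 1 = z.
Proof.
move: z; apply: (@tens_eq _ (tens_ract^~ 1) id) => //; first exact: tens_ractD.
by move=> x y; rewrite tens_ractE ract1.
Qed.
Fact tens_ractM z a b : tens_ract z (a * b) = tens_ract (tens_ract z a) b.
Proof.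
move: z; apply: (@tens_eq _ (tens_ract^~ (a * b))
  (fun z => tens_ract (tens_ract z a) b)).
- exact: tens_ractD.
- by move=> u v; rewrite !tens_ractD.
- by move=> x y; rewrite !tens_ractE ractM.
Qed.
Fact tens_lractA a z b :
  tens_ract (tens_lact a z) b = tens_lact a (tens_ract z b).
Proof.
move: z; apply: (@tens_eq _ (fun z => tens_ract (tens_lact a z) b)
  (fun z => tens_lact a (tens_ract z b))).
- by move=> u v; rewrite tens_lactD tens_ractD.
- by move=> u v; rewrite tens_ractD tens_lactD.
- by move=> x y; rewrite tens_lactE !tens_ractE tens_lactE.
Qed.

Definition tensor : bimodule A :=
  @Bimodule k A tens_type tens_lact tens_ract
    tens_lact_linearl tens_lact_linearr tens_ract_linearl tens_ract_linearr
    tens_lact1 tens_lactM tens_ract1 tens_ractM tens_lractA.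

End Tensor.

Section TensorMap.
Variables (k : fieldType) (A : falgType k).

Section Map.
Variables (M M' N N' : bimodule A).
Variables (f : bimod_hom M M') (g : bimod_hom N N').

Fact tensor_map_bal : balanced (fun x y => tens (f x) (g y)).
Proof.
split=> [x x' y|x y y'|x a y]; first by rewrite homD tensDl.
  by rewrite homD tensDr.
by rewrite hom_ract tens_bal hom_lact.
Qed.

Definition tensor_map_fun : tensor M N -> tensor M' N' :=
  tens_lift (fun x y => tens (f x) (g y)).

Lemma tensor_map_funE x y : tensor_map_fun (tens x y) = tens (f x) (g y).
Proof. exact: (tens_liftE _ _ tensor_map_bal). Qed.
Fact tensor_map_funD z w :
  tensor_map_fun (z + w) = tensor_map_fun z + tensor_map_fun w.
Proof. exact: (tens_liftD _ _ tensor_map_bal). Qed.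
Fact tensor_map_linear : linear tensor_map_fun.
Proof.
move=> c z w; rewrite tensor_map_funD; congr (_ + _).
by apply: (@tens_liftZ k A M N (tensor M' N') _ c z tensor_map_bal) => x y; rewrite homZ tensZl.
Qed.
Fact tensor_map_lact a z :
  tensor_map_fun (lact a z) = lact a (tensor_map_fun z).
Proof.
move: z; apply: (@tens_eq _ _ _ _ _ (fun z => tensor_map_fun (tens_lact a z))
  (fun z => tens_lact a (tensor_map_fun z))).
- by move=> z w; rewrite tens_lactD tensor_map_funD.
- by move=> z w; rewrite tensor_map_funD tens_lactD.
- by move=> x y; rewrite tens_lactE !tensor_map_funE tens_lactE hom_lact.
Qed.
Fact tensor_map_ract z a :
  tensor_map_fun (ract z a) = ract (tensor_map_fun z) a.
Proof.
move: z; apply: (@tens_eq _ _ _ _ _ (fun z => tensor_map_fun (tens_ract z a))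
  (fun z => tens_ract (tensor_map_fun z) a)).
- by move=> z w; rewrite tens_ractD tensor_map_funD.
- by move=> z w; rewrite tensor_map_funD tens_ractD.
- by move=> x y; rewrite tens_ractE !tensor_map_funE tens_ractE hom_ract.
Qed.

(* No Koszul sign here: see ctens_map. *)
Definition tensor_map : bimod_hom (tensor M N) (tensor M' N') :=
  BimodHom tensor_map_linear tensor_map_lact tensor_map_ract.

Lemma tensor_mapE x y : tensor_map (tens x y) = tens (f x) (g y).
Proof. exact: tensor_map_funE. Qed.

End Map.

Local Notation regA := (regular_bimodule A).

Fact tensor_mul_bal :
  @balanced k A regA regA regA (fun a b => (a : A) * (b : A)).
Proof.
by split=> [x x' y|x y y'|x a y] /=; rewrite ?mulrDl ?mulrDr ?mulrA.
Qed.

Definition tensor_mul_fun : tensor regA regA -> regA :=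
  @tens_lift k A regA regA regA (fun a b => (a : A) * (b : A)).

Lemma tensor_mul_funE (a b : regA) :
  tensor_mul_fun (tens a b) = (a : A) * (b : A).
Proof. exact: (tens_liftE _ _ tensor_mul_bal). Qed.
Fact tensor_mul_funD z w :
  tensor_mul_fun (z + w) = tensor_mul_fun z + tensor_mul_fun w.
Proof. exact: (tens_liftD _ _ tensor_mul_bal). Qed.
Fact tensor_mul_linear : linear tensor_mul_fun.
Proof.
move=> c z w; rewrite tensor_mul_funD; congr (_ + _).
by apply: (@tens_liftZ k A regA regA regA _ c z tensor_mul_bal) => x y; rewrite /= scalerAl.
Qed.
Fact tensor_mul_lact a z :
  tensor_mul_fun (lact a z) = lact a (tensor_mul_fun z).
Proof.
move: z; apply: (@tens_eq _ _ _ _ regA (fun z => tensor_mul_fun (tens_lact a z))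
  (fun z => lact a (tensor_mul_fun z))).
- by move=> z w; rewrite tens_lactD tensor_mul_funD.
- by move=> z w; rewrite tensor_mul_funD lactDr.
- by move=> x y; rewrite tens_lactE !tensor_mul_funE /= mulrA.
Qed.
Fact tensor_mul_ract z a :
  tensor_mul_fun (ract z a) = ract (tensor_mul_fun z) a.
Proof.
move: z; apply: (@tens_eq _ _ _ _ regA (fun z => tensor_mul_fun (tens_ract z a))
  (fun z => ract (tensor_mul_fun z) a)).
- by move=> z w; rewrite tens_ractD tensor_mul_funD.
- by move=> z w; rewrite tensor_mul_funD ractDl.
- by move=> x y; rewrite tens_ractE !tensor_mul_funE /= mulrA.
Qed.

(* The canonical isomorphism A (x)_A A -> A, a (x) b |-> a * b. *)
Definition tensor_mul : bimod_hom (tensor regA regA) regA :=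
  BimodHom tensor_mul_linear tensor_mul_lact tensor_mul_ract.

Lemma tensor_mulE (a b : regA) : tensor_mul (tens a b) = (a : A) * (b : A).
Proof. exact: tensor_mul_funE. Qed.

End TensorMap.

Section TensorMapTheory.
Variables (k : fieldType) (A : falgType k).

Fact hom_id_linear (M : bimodule A) : linear (fun x : M => x).
Proof. by []. Qed.

Definition hom_id (M : bimodule A) : bimod_hom M M :=
  @BimodHom k A M M (fun x => x) (@hom_id_linear M)
    (fun a x => erefl (lact a x)) (fun x a => erefl (ract x a)).

Lemma hom_comp1l (M N : bimodule A) (f : bimod_hom M N) :
  hom_comp (hom_id N) f = f.
Proof. exact: hom_ext. Qed.

Lemma hom_comp1r (M N : bimodule A) (f : bimod_hom M N) :
  hom_comp f (hom_id M) = f.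
Proof. exact: hom_ext. Qed.

Lemma tensor_map_comp (M M' M'' N N' N'' : bimodule A)
    (f' : bimod_hom M' M'') (f : bimod_hom M M')
    (g' : bimod_hom N' N'') (g : bimod_hom N N') z :
  tensor_map f' g' (tensor_map f g z)
  = tensor_map (hom_comp f' f) (hom_comp g' g) z.
Proof.
move: z; apply: (@tens_eq _ _ M N (tensor M'' N'')
  (fun z => tensor_map f' g' (tensor_map f g z))
  (tensor_map (hom_comp f' f) (hom_comp g' g))).
- by move=> z w; rewrite !homD.
- by move=> z w; rewrite homD.
- by move=> x y; rewrite !tensor_mapE.
Qed.

Lemma tensor_map0l (M M' N N' : bimodule A) (g : bimod_hom N N') z :
  tensor_map (0 : bimod_hom M M') g z = 0.
Proof.
move: z; apply: (@tens_eq _ _ M N (tensor M' N')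
  (tensor_map (0 : bimod_hom M M') g) (fun=> 0)).
- by move=> z w; rewrite homD.
- by move=> z w; rewrite addr0.
- by move=> x y; rewrite tensor_mapE hom0E -(scale0r (0 : M')) tensZl scale0r.
Qed.

Lemma tensor_map0r (M M' N N' : bimodule A) (f : bimod_hom M M') z :
  tensor_map f (0 : bimod_hom N N') z = 0.
Proof.
move: z; apply: (@tens_eq _ _ M N (tensor M' N')
  (tensor_map f (0 : bimod_hom N N')) (fun=> 0)).
- by move=> z w; rewrite homD.
- by move=> z w; rewrite addr0.
- by move=> x y; rewrite tensor_mapE hom0E -(scale0r (0 : N')) tensZr scale0r.
Qed.

Lemma tensor_mapPl (M M' N N' : bimodule A) c (f f' : bimod_hom M M')
    (g : bimod_hom N N') z :
  tensor_map (c *: f + f') g z = c *: tensor_map f g z + tensor_map f' g z.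
Proof.
move: z; apply: (@tens_eq _ _ M N (tensor M' N') (tensor_map (c *: f + f') g)
  (fun z => c *: tensor_map f g z + tensor_map f' g z)).
- by move=> z w; rewrite homD.
- by move=> z w; rewrite !homD scalerDr addrACA.
- by move=> x y; rewrite !tensor_mapE tensDl tensZl.
Qed.

Lemma tensor_mapPr (M M' N N' : bimodule A) c (f : bimod_hom M M')
    (g g' : bimod_hom N N') z :
  tensor_map f (c *: g + g') z = c *: tensor_map f g z + tensor_map f g' z.
Proof.
move: z; apply: (@tens_eq _ _ M N (tensor M' N') (tensor_map f (c *: g + g'))
  (fun z => c *: tensor_map f g z + tensor_map f g' z)).
- by move=> z w; rewrite homD.
- by move=> z w; rewrite !homD scalerDr addrACA.
- by move=> x y; rewrite !tensor_mapE tensDr tensZr.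
Qed.

Lemma tensor_mapZl (M M' N N' : bimodule A) c (f : bimod_hom M M')
    (g : bimod_hom N N') z :
  tensor_map (c *: f) g z = c *: tensor_map f g z.
Proof. by rewrite -[c *: f]addr0 tensor_mapPl tensor_map0l addr0. Qed.

Lemma tensor_mapZr (M M' N N' : bimodule A) c (f : bimod_hom M M')
    (g : bimod_hom N N') z :
  tensor_map f (c *: g) z = c *: tensor_map f g z.
Proof. by rewrite -[c *: g]addr0 tensor_mapPr tensor_map0r addr0. Qed.

End TensorMapTheory.

Definition dprod_type (k : fieldType) (A : falgType k) (I : Type)
    (V : I -> bimodule A) : Type := forall i, V i.

Section Product.
Variables (k : fieldType) (A : falgType k) (I : Type) (V : I -> bimodule A).
Local Notation P := (dprod_type V).
Implicit Types (z w : P).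

HB.instance Definition _ := gen_eqMixin P.
HB.instance Definition _ := gen_choiceMixin P.

Lemma dprod_ext z w : (forall i, z i = w i) -> z = w.
Proof. exact: functional_extensionality_dep. Qed.

Definition dprod_zero : P := fun=> 0.
Definition dprod_opp z : P := fun i => - z i.
Definition dprod_add z w : P := fun i => z i + w i.
Definition dprod_scale (c : k) z : P := fun i => c *: z i.
Definition dprod_lact a z : P := fun i => lact a (z i).
Definition dprod_ract z a : P := fun i => ract (z i) a.

Fact dprod_addA : associative dprod_add.
Proof. by move=> z w u; apply: dprod_ext => i; apply: addrA. Qed.
Fact dprod_addC : commutative dprod_add.
Proof. by move=> z w; apply: dprod_ext => i; apply: addrC. Qed.
Fact dprod_add0 : left_id dprod_zero dprod_add.
Proof. by move=> z; apply: dprod_ext => i; apply: add0r. Qed.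
Fact dprod_addN : left_inverse dprod_zero dprod_opp dprod_add.
Proof. by move=> z; apply: dprod_ext => i; apply: addNr. Qed.

HB.instance Definition _ := GRing.isZmodule.Build P
  dprod_addA dprod_addC dprod_add0 dprod_addN.

Fact dprod_scaleA a b z : dprod_scale a (dprod_scale b z) = dprod_scale (a * b) z.
Proof. by apply: dprod_ext => i; apply: scalerA. Qed.
Fact dprod_scale1 : left_id 1 dprod_scale.
Proof. by move=> z; apply: dprod_ext => i; apply: scale1r. Qed.
Fact dprod_scaleDr : right_distributive dprod_scale +%R.
Proof. by move=> a z w; apply: dprod_ext => i; apply: scalerDr. Qed.
Fact dprod_scaleDl z : {morph dprod_scale^~ z : a b / a + b}.
Proof. by move=> a b; apply: dprod_ext => i; apply: scalerDl. Qed.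

HB.instance Definition _ := GRing.Zmodule_isLmodule.Build k P
  dprod_scaleA dprod_scale1 dprod_scaleDr dprod_scaleDl.

Lemma dprodDE z w i : (z + w) i = z i + w i. Proof. by []. Qed.
Lemma dprodZE c z i : (c *: z) i = c *: z i. Proof. by []. Qed.
Lemma dprod0E i : (0 : P) i = 0. Proof. by []. Qed.

Fact dprod_lact_linearl z : linear (dprod_lact^~ z).
Proof. by move=> c a b; apply: dprod_ext => i; apply: lact_linearl. Qed.
Fact dprod_lact_linearr a : linear (dprod_lact a).
Proof. by move=> c z w; apply: dprod_ext => i; apply: lact_linearr. Qed.
Fact dprod_ract_linearl a : linear (dprod_ract^~ a).
Proof. by move=> c z w; apply: dprod_ext => i; apply: ract_linearl. Qed.
Fact dprod_ract_linearr z : linear (dprod_ract z).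
Proof. by move=> c a b; apply: dprod_ext => i; apply: ract_linearr. Qed.
Fact dprod_lact1 z : dprod_lact 1 z = z.
Proof. by apply: dprod_ext => i; apply: lact1. Qed.
Fact dprod_lactM a b z : dprod_lact (a * b) z = dprod_lact a (dprod_lact b z).
Proof. by apply: dprod_ext => i; apply: lactM. Qed.
Fact dprod_ract1 z : dprod_ract z 1 = z.
Proof. by apply: dprod_ext => i; apply: ract1. Qed.
Fact dprod_ractM z a b : dprod_ract z (a * b) = dprod_ract (dprod_ract z a) b.
Proof. by apply: dprod_ext => i; apply: ractM. Qed.
Fact dprod_lractA a z b :
  dprod_ract (dprod_lact a z) b = dprod_lact a (dprod_ract z b).
Proof. by apply: dprod_ext => i; apply: lractA. Qed.

Definition dprod : bimodule A :=
  @Bimodule k A P dprod_lact dprod_ract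
    dprod_lact_linearl dprod_lact_linearr dprod_ract_linearl dprod_ract_linearr
    dprod_lact1 dprod_lactM dprod_ract1 dprod_ractM dprod_lractA.

Lemma dprod_lactE a (z : dprod) i : (lact a z : P) i = lact a ((z : P) i).
Proof. by []. Qed.
Lemma dprod_ractE (z : dprod) a i : (ract z a : P) i = ract ((z : P) i) a.
Proof. by []. Qed.

Definition dprod_proj (i : I) : bimod_hom dprod (V i) :=
  @BimodHom k A dprod (V i) (fun z : P => z i) (fun c z w => erefl)
    (fun a z => erefl) (fun z a => erefl).

End Product.

(* diff is indexed by both its source and its target degree, with a proof
   that they are consecutive, so that no transport along equalities between
   degrees is ever needed. *)
Record complex (k : fieldType) (A : falgType k) := Complex {
  component :> int -> bimodule A;
  diff : forall i j : int, i = j + 1 -> bimod_hom (component i) (component j);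
  diffK : forall (i j l : int) (Hij : i = j + 1) (Hjl : j = l + 1) x,
    diff Hjl (diff Hij x) = 0
}.
Arguments diff {k A} c {i j} H.

Lemma diff_comp0 (k : fieldType) (A : falgType k) (C : complex A) (i j l : int)
    (Hij : i = j + 1) (Hjl : j = l + 1) :
  hom_comp (diff C Hjl) (diff C Hij) = 0.
Proof. by apply: hom_ext => x; apply: diffK. Qed.

Record chain_map (k : fieldType) (A : falgType k) (C D : complex A) :=
  ChainMap {
    chain_map_hom :> forall n : int, bimod_hom (C n) (D n);
    chain_mapP : forall (i j : int) (H : i = j + 1) x,
      chain_map_hom j (diff C H x) = diff D H (chain_map_hom i x)
  }.

Definition acyclic (k : fieldType) (A : falgType k) (C : complex A) : Prop :=
  forall (i j l : int) (Hij : i = j + 1) (Hjl : j = l + 1) (y : C j),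
    diff C Hjl y = 0 -> exists x : C i, diff C Hij x = y.

(* The pairs (n - i, i), i an integer, without the transports that indexing the
   n-th component of a complete tensor product by i would require. *)
Record bidegree (n : int) := Bidegree {
  deg1 : int;
  deg2 : int;
  bidegreeP : deg1 + deg2 = n
}.

Section CompleteTensor.
Variables (k : fieldType) (A : falgType k) (C D : complex A).

Definition ctens_component (n : int) : bimodule A :=
  dprod (fun pq : bidegree n => tensor (C (deg1 pq)) (D (deg2 pq))).

Fact bidegree_succl (n m : int) (H : n = m + 1) (pq : bidegree m) :
  deg1 pq + 1 + deg2 pq = n.
Proof. by rewrite H addrAC (bidegreeP pq). Qed.
Fact bidegree_succr (n m : int) (H : n = m + 1) (pq : bidegree m) :
  deg1 pq + (deg2 pq + 1) = n.
Proof. by rewrite H addrA (bidegreeP pq). Qed.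

(* The component in bidegree (p, q) of the differential of z collects
   d(x) (x) y from bidegree (p + 1, q) and (-1)^p x (x) d(y) from
   bidegree (p, q + 1). *)
Definition ctens_diff_fun (n m : int) (H : n = m + 1)
    (z : ctens_component n) : ctens_component m :=
  fun pq : bidegree m =>
    tensor_map (diff C erefl) (hom_id (D (deg2 pq)))
      (z (Bidegree (bidegree_succl H pq)))
    + (-1) ^ deg1 pq *:
      tensor_map (hom_id (C (deg1 pq))) (diff D erefl)
        (z (Bidegree (bidegree_succr H pq))).

Lemma ctens_diff_funE n m (H : n = m + 1) z pq :
  ctens_diff_fun H z pq =
    tensor_map (diff C erefl) (hom_id (D (deg2 pq)))
      (z (Bidegree (bidegree_succl H pq)))
    + (-1) ^ deg1 pq *:
      tensor_map (hom_id (C (deg1 pq))) (diff D erefl)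
        (z (Bidegree (bidegree_succr H pq))).
Proof. by []. Qed.

Fact ctens_diff_linear n m (H : n = m + 1) : linear (ctens_diff_fun H).
Proof.
move=> c z w; apply: dprod_ext => pq; rewrite dprodDE dprodZE /ctens_diff_fun.
rewrite !dprodDE !dprodZE !homD !homZ !scalerDr !scalerA.
by rewrite [in RHS](mulrC c) addrACA.
Qed.
Fact ctens_diff_lact n m (H : n = m + 1) a z :
  ctens_diff_fun H (lact a z) = lact a (ctens_diff_fun H z).
Proof.
apply: dprod_ext => pq; rewrite dprod_lactE /ctens_diff_fun !dprod_lactE.
by rewrite !hom_lact lactDr lactZr.
Qed.
Fact ctens_diff_ract n m (H : n = m + 1) z a :
  ctens_diff_fun H (ract z a) = ract (ctens_diff_fun H z) a.
Proof.
apply: dprod_ext => pq; rewrite dprod_ractE /ctens_diff_fun !dprod_ractE.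
by rewrite !hom_ract ractDl ractZl.
Qed.

Definition ctens_diff n m (H : n = m + 1) :
  bimod_hom (ctens_component n) (ctens_component m) :=
  BimodHom (ctens_diff_linear H) (ctens_diff_lact H) (ctens_diff_ract H).

Fact ctens_diffK (i j l : int) (Hij : i = j + 1) (Hjl : j = l + 1) z :
  ctens_diff Hjl (ctens_diff Hij z) = 0.
Proof.
apply: dprod_ext => pq; rewrite dprod0E.
change (ctens_diff_fun Hjl (ctens_diff_fun Hij z) pq = 0).
rewrite !ctens_diff_funE; cbn [deg1 deg2].
rewrite !homD !homZ !tensor_map_comp !diff_comp0 tensor_map0l tensor_map0r.
rewrite !scaler0 add0r addr0 !hom_comp1l !hom_comp1r.
rewrite (Prop_irrelevance (bidegree_succr Hij (Bidegree (bidegree_succl Hjl pq)))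
  (bidegree_succl Hij (Bidegree (bidegree_succr Hjl pq)))).
by rewrite -scalerDl expfzDr ?oppr_eq0 ?oner_eq0 // expr1z mulrN1 addNr scale0r.
Qed.

Definition ctens : complex A := Complex ctens_diffK.

End CompleteTensor.

Definition ctens_map (k : fieldType) (A : falgType k) (C D : complex A)
    (M N : bimodule A) (r s n : int) (H : r + s = n)
    (u : bimod_hom (C r) M) (v : bimod_hom (D s) N) :
  bimod_hom (ctens C D n) (tensor M N) :=
  (-1) ^ (r * s) *: hom_comp (tensor_map u v)
    (dprod_proj (fun pq : bidegree n => tensor (C (deg1 pq)) (D (deg2 pq)))
       (Bidegree H)).

Record complete_resolution (k : fieldType) (A : falgType k) :=
  CompleteResolution {
    cr_complex :> complex A;
    cr_fg : forall i : int, finitely_generated (cr_complex i);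
    cr_proj : forall i : int, projective (cr_complex i);
    cr_acyclic : acyclic cr_complex;
    cr_aug : bimod_hom (cr_complex 0) (regular_bimodule A);
    cr_coaug : bimod_hom (regular_bimodule A) (cr_complex (-1));
    cr_aug_surj : forall a, exists x, cr_aug x = a;
    cr_coaug_inj : injective cr_coaug;
    cr_factor : forall (H : 0 = -1 + 1 :> int) x,
      diff cr_complex H x = cr_coaug (cr_aug x)
  }.

Record augmented_chain_map (k : fieldType) (A : falgType k)
    (T T' : complete_resolution A) := AugmentedChainMap {
  acm_map :> chain_map T T';
  acm_aug : forall x, cr_aug T' (acm_map 0 x) = cr_aug T x
}.

(* The augmentation vanishes outside degree 0, so compatibility with it is
   only a condition in degree 0, on the component in bidegree (0, 0); the
   target A (x)_A A is identified with A by multiplication. *)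
Record diagonal_approximation (k : fieldType) (A : falgType k)
    (T : complete_resolution A) := DiagonalApproximation {
  diag_map :> chain_map T (ctens T T);
  diag_aug : forall x,
    tensor_mul A (ctens_map (addr0 0) (cr_aug T) (cr_aug T) (diag_map 0 x))
    = cr_aug T x
}.

Section Cohomology.
Variables (k : fieldType) (A : falgType k) (C : complex A) (M : bimodule A).

Definition codiff (n m : int) (H : m = n + 1) (f : bimod_hom (C n) M) :
  bimod_hom (C m) M := (- (-1) ^ n) *: hom_comp f (diff C H).

Lemma codiffP n m (H : m = n + 1) c f g :
  codiff H (c *: f + g) = c *: codiff H f + codiff H g.
Proof.
by apply: hom_ext => x; rewrite /= !scalerDr !scalerA [in RHS]mulrC.
Qed.

Lemma codiffD n m (H : m = n + 1) f g :
  codiff H (f + g) = codiff H f + codiff H g.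
Proof. exact: (lin_add (codiffP H)). Qed.

Lemma codiffZ n m (H : m = n + 1) c f : codiff H (c *: f) = c *: codiff H f.
Proof. exact: (lin_scale (codiffP H)). Qed.

Lemma codiff0 n m (H : m = n + 1) : codiff H 0 = 0.
Proof. by rewrite -(scale0r 0) codiffZ scale0r. Qed.

Lemma codiffN n m (H : m = n + 1) f : codiff H (- f) = - codiff H f.
Proof. by rewrite -scaleN1r codiffZ scaleN1r. Qed.

Lemma codiffK (n m l : int) (H : m = n + 1) (H' : l = m + 1) f :
  codiff H' (codiff H f) = 0.
Proof.
by apply: hom_ext => x; rewrite /= diffK hom0 !scaler0.
Qed.

Variable n : int.

Definition is_cocycle : {pred bimod_hom (C n) M} :=
  [pred f | `[< forall (m : int) (H : m = n + 1), codiff H f = 0 >]].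

Fact is_cocycle_submod : submod_closed is_cocycle.
Proof.
split=> [|c f g /asboolP f0 /asboolP g0]; apply/asboolP => m H.
  exact: codiff0.
by rewrite codiffP f0 g0 scaler0 addr0.
Qed.
HB.instance Definition _ :=
  GRing.isSubmodClosed.Build k (bimod_hom (C n) M) is_cocycle is_cocycle_submod.

Record cocycle := Cocycle {
  cochain_of :> bimod_hom (C n) M;
  cocycleP : cochain_of \in is_cocycle
}.

HB.instance Definition _ := [isSub for cochain_of].
HB.instance Definition _ := [Choice of cocycle by <:].
HB.instance Definition _ := [SubChoice_isSubLmodule of cocycle by <:].

Lemma cocycleE (u : cocycle) (m : int) (H : m = n + 1) : codiff H u = 0.
Proof. by have /asboolP := cocycleP u; apply. Qed.

Definition is_coboundary : {pred cocycle} :=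
  [pred u : cocycle |
    `[< exists (m : int) (H : n = m + 1) (g : bimod_hom (C m) M),
          codiff H g = u >]].

Fact is_coboundary_submod : submod_closed is_coboundary.
Proof.
split=> [|c u v /asboolP[m [H [g gu]]] /asboolP[m' [H' [h hv]]]];
  apply/asboolP.
  by exists (n - 1), (esym (subrK 1 n)), 0; rewrite codiff0.
have em : m' = m by apply: (addIr 1); rewrite -H -H'.
subst m'; rewrite (Prop_irrelevance H' H) in hv.
by exists m, H, (c *: g + h); rewrite codiffP gu hv.
Qed.
HB.instance Definition _ :=
  GRing.isSubmodClosed.Build k cocycle is_coboundary is_coboundary_submod.

Definition cohomology : Type := Quotient.quot is_coboundary.
HB.instance Definition _ := GRing.Zmodule.on cohomology.

Definition coclass (u : cocycle) : cohomology := \pi_(Quotient.quot is_coboundary) u.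
Definition corepr (a : cohomology) : cocycle := repr (a : Quotient.quot is_coboundary).

Lemma coreprK a : coclass (corepr a) = a.
Proof. exact: reprK. Qed.

Lemma coclassP u v : coclass u = coclass v <-> u - v \in is_coboundary.
Proof. by rewrite Quotient.idealrBE; split => [/eqP|/eqP]. Qed.

Lemma coclassD u v : coclass (u + v) = coclass u + coclass v.
Proof. by rewrite /coclass !piE. Qed.

Definition coscale (c : k) (a : cohomology) := coclass (c *: corepr a).

Lemma coscaleE c u : coscale c (coclass u) = coclass (c *: u).
Proof.
apply/coclassP; rewrite -scalerBr; apply: rpredZ.
by apply/coclassP; rewrite coreprK.
Qed.

Fact coscaleA a b x : coscale a (coscale b x) = coscale (a * b) x.
Proof. by rewrite -(coreprK x) !coscaleE scalerA. Qed.
Fact coscale1 : left_id 1 coscale.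
Proof. by move=> x; rewrite -(coreprK x) coscaleE scale1r. Qed.
Fact coscaleDr : right_distributive coscale +%R.
Proof.
move=> a x y; rewrite -(coreprK x) -(coreprK y).
by rewrite -coclassD !coscaleE -coclassD scalerDr.
Qed.
Fact coscaleDl x : {morph coscale^~ x : a b / a + b}.
Proof.
by move=> a b; rewrite -(coreprK x) !coscaleE -coclassD scalerDl.
Qed.

HB.instance Definition _ := GRing.Zmodule_isLmodule.Build k cohomology
  coscaleA coscale1 coscaleDr coscaleDl.

Lemma coclassZ c u : coclass (c *: u) = c *: coclass u.
Proof. by rewrite [RHS]coscaleE. Qed.

End Cohomology.
Arguments is_cocycle {k A} C M n.
Arguments is_coboundary {k A} C M n.

Section CohomologyMap.
Variables (k : fieldType) (A : falgType k) (C D : complex A) (M : bimodule A).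
Variable f : chain_map C D.

Lemma codiff_comp (n m : int) (H : m = n + 1) (u : bimod_hom (D n) M) :
  codiff H (hom_comp u (f n)) = hom_comp (codiff H u) (f m).
Proof. by apply: hom_ext => x; rewrite /= chain_mapP. Qed.

Variable n : int.

Fact cocycle_comp (u : cocycle D M n) : hom_comp u (f n) \in is_cocycle C M n.
Proof.
apply/asboolP => m H; rewrite codiff_comp cocycleE.
exact: hom_ext.
Qed.

Definition cocycle_map (u : cocycle D M n) : cocycle C M n :=
  Cocycle (cocycle_comp u).

Definition cohomology_map (a : cohomology D M n) : cohomology C M n :=
  coclass (cocycle_map (corepr a)).

Lemma cohomology_mapE u : cohomology_map (coclass u) = coclass (cocycle_map u).
Proof.
apply/coclassP/asboolP.
have /coclassP/asboolP[m [H [g gu]]] := coreprK (coclass u).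
exists m, H, (hom_comp g (f m)); rewrite codiff_comp gu.
exact: hom_ext.
Qed.

End CohomologyMap.

Section Cup.
Variables (k : fieldType) (A : falgType k) (T : complete_resolution A).
Variables (Delta : diagonal_approximation T) (M N : bimodule A).

Definition cup_cochain (r s n : int) (H : r + s = n)
    (u : bimod_hom (T r) M) (v : bimod_hom (T s) N) :
  bimod_hom (T n) (tensor M N) :=
  hom_comp (ctens_map H u v) (Delta n).

Lemma cup_cochainPl r s n (H : r + s = n) c u u' v :
  cup_cochain H (c *: u + u') v = c *: cup_cochain H u v + cup_cochain H u' v.
Proof.
apply: hom_ext => x; rewrite homDE homZE /=.
by rewrite [tensor_map_fun _ _ _]tensor_mapPl scalerDr !scalerA mulrC.
Qed.

Lemma cup_cochainPr r s n (H : r + s = n) c u v v' :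
  cup_cochain H u (c *: v + v') = c *: cup_cochain H u v + cup_cochain H u v'.
Proof.
apply: hom_ext => x; rewrite homDE homZE /=.
by rewrite [tensor_map_fun _ _ _]tensor_mapPr scalerDr !scalerA mulrC.
Qed.

Lemma cup_cochainBl r s n (H : r + s = n) u u' v :
  cup_cochain H (u - u') v = cup_cochain H u v - cup_cochain H u' v.
Proof.
by rewrite addrC -scaleN1r cup_cochainPl scaleN1r addrC.
Qed.

Lemma cup_cochainBr r s n (H : r + s = n) u v v' :
  cup_cochain H u (v - v') = cup_cochain H u v - cup_cochain H u v'.
Proof.
by rewrite addrC -scaleN1r cup_cochainPr scaleN1r addrC.
Qed.

Lemma cup_cochain0l r s n (H : r + s = n) v : cup_cochain H 0 v = 0.
Proof.
apply: hom_ext => x; rewrite /= [tensor_map_fun _ _ _]tensor_map0l.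
exact: scaler0.
Qed.

Lemma cup_cochain0r r s n (H : r + s = n) u : cup_cochain H u 0 = 0.
Proof.
apply: hom_ext => x; rewrite /= [tensor_map_fun _ _ _]tensor_map0r.
exact: scaler0.
Qed.

Lemma codiff_cup (r s n r' s' m : int) (Hn : r + s = n) (Hr : r' = r + 1)
    (Hs : s' = s + 1) (Hm : m = n + 1) (H1 : r' + s = m) (H2 : r + s' = m)
    (u : bimod_hom (T r) M) (v : bimod_hom (T s) N) :
  codiff Hm (cup_cochain Hn u v)
  = cup_cochain H1 (codiff Hr u) v + (-1) ^ r *: cup_cochain H2 u (codiff Hs v).
Proof.
subst r' s'; apply: hom_ext => x.
rewrite homDE homZE /cup_cochain /codiff /ctens_map /= chain_mapP.
move: (Delta m x) => z.
change (diff (ctens T T) Hm z (Bidegree Hn)) with (ctens_diff_fun Hm z (Bidegree Hn)).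
rewrite ctens_diff_funE; cbn [deg1 deg2].
rewrite (Prop_irrelevance H1 (bidegree_succl Hm (Bidegree Hn))).
rewrite (Prop_irrelevance H2 (bidegree_succr Hm (Bidegree Hn))).
rewrite -![tensor_map_fun _ _ _]/(tensor_map _ _ _).
rewrite homD homZ !tensor_map_comp !hom_comp1r tensor_mapZl tensor_mapZr.
have N1 : (-1 : k) != 0 by rewrite oppr_eq0 oner_eq0.
rewrite !scalerDr !scalerA; congr (_ *: _ + _ *: _); rewrite -Hn.
  rewrite mulrDl mul1r !expfzDr // mulNr mulrN; congr (- _).
  by rewrite mulrC mulrA mulrAC.
rewrite mulrDr mulr1 !expfzDr // !mulNr !mulrN; congr (- _).
by rewrite -!mulrA; congr (_ * _); rewrite mulrC -mulrA.
Qed.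

Fact cup_cocycle (r s : int) (u : cocycle T M r) (v : cocycle T N s) :
  cup_cochain (erefl (r + s)) u v \in is_cocycle T (tensor M N) (r + s).
Proof.
apply/asboolP => m H.
have H1 : r + 1 + s = m by rewrite H addrAC.
have H2 : r + (s + 1) = m by rewrite H addrA.
rewrite (codiff_cup erefl erefl erefl H H1 H2) !cocycleE.
by rewrite cup_cochain0l cup_cochain0r scaler0 addr0.
Qed.

Definition cup_cocycles (r s : int) (u : cocycle T M r) (v : cocycle T N s) :
  cocycle T (tensor M N) (r + s) := Cocycle (cup_cocycle u v).

Definition cup (r s : int) (a : cohomology T M r) (b : cohomology T N s) :
  cohomology T (tensor M N) (r + s) :=
  coclass (cup_cocycles (corepr a) (corepr b)).

Lemma cupE (r s : int) (u : cocycle T M r) (v : cocycle T N s) :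
  cup (coclass u) (coclass v) = coclass (cup_cocycles u v).
Proof.
have /coclassP/asboolP[p [Hp [g gu]]] := coreprK (coclass u).
have /coclassP/asboolP[q [Hq [h hv]]] := coreprK (coclass v).
rewrite /cup; move: (corepr (coclass u)) (corepr (coclass v)) gu hv.
move=> u' v' gu hv.
transitivity (coclass (cup_cocycles u v')); apply/coclassP/asboolP.
- have Hpn : r + s = p + s + 1 by rewrite Hp addrAC.
  have Hps : p + (s + 1) = r + s by rewrite Hp addrAC addrA.
  exists (p + s), Hpn, (cup_cochain erefl g v').
  rewrite (codiff_cup erefl Hp erefl Hpn erefl Hps) cocycleE cup_cochain0r.
  by rewrite scaler0 addr0 gu cup_cochainBl.
- have Hqn : r + s = r + q + 1 by rewrite Hq addrA.
  have Hrq : r + 1 + q = r + s by rewrite Hq addrAC addrA.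
  exists (r + q), Hqn, ((-1) ^ r *: cup_cochain erefl u h).
  rewrite codiffZ (codiff_cup erefl erefl Hq Hqn Hrq erefl) cocycleE.
  rewrite cup_cochain0l add0r hv scalerA -expfzMl mulrNN mul1r exp1rz scale1r.
  exact: cup_cochainBr.
Qed.

Lemma cup_linearl (r s : int) (b : cohomology T N s) :
  linear (fun a : cohomology T M r => cup a b).
Proof.
move=> c a a'; rewrite -(coreprK a) -(coreprK a') -(coreprK b).
rewrite -coclassZ -coclassD !cupE -coclassZ -coclassD.
congr coclass; apply: val_inj; exact: cup_cochainPl.
Qed.

Lemma cup_linearr (r s : int) (a : cohomology T M r) :
  linear (fun b : cohomology T N s => cup a b).
Proof.
move=> c b b'; rewrite -(coreprK a) -(coreprK b) -(coreprK b').
rewrite -coclassZ -coclassD !cupE -coclassZ -coclassD.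
congr coclass; apply: val_inj; exact: cup_cochainPr.
Qed.

End Cup.

(* Main.v *)
(* By the Frobenius form, A carries a Casimir element sum x_i (x) y_i with
   a x_i (x) y_i = x_i (x) y_i a. Averaging with it turns k-linear maps into
   bimodule maps (Higman's trace), so that maps out of a projective lift and
   maps into a projective extend as soon as they do so k-linearly, which is
   automatic for exact complexes of finite dimensional spaces; the same holds
   after tensoring such a complex with a projective bimodule.
   For f : T -> T' let h be the difference of the two chain maps Delta' f and
   (f (x) f) Delta from T to the complete tensor product of T' with itself. A
   null-homotopy of h is built row by row. On the row 0, (eps (x) 1) h : T -> T'
   vanishes after eps, hence is null-homotopic, and such a homotopy lifts
   along eps (x) 1. The rows p > 0 are then filled by lifting along exact columns,
   and each row p < 0 because every chain map from T to T'_p (x) T' is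
   null-homotopic. Therefore (u (x) v) h is a coboundary for cocycles u, v. *)

From HB Require Import structures.
Require Import Defs.
From mathcomp Require Import all_boot all_order all_algebra falgebra.
From mathcomp Require Import boolp.

Set Implicit Arguments.
Unset Strict Implicit.
Unset Printing Implicit Defensive.

Import GRing.Theory.
Local Open Scope ring_scope.

(** * Finite dimensional linear algebra and choice along the integers *)

Section FiniteDimension.
Variable k : fieldType.
Implicit Types U V W : lmodType k.

Lemma lin_zero V W (f : V -> W) : linear f -> f 0 = 0.
Proof. by move=> fL; rewrite -(scale0r 0) (lin_scale fL) scale0r. Qed.

Lemma lin_opp V W (f : V -> W) : linear f -> {morph f : x / - x}.
Proof. by move=> fL x; rewrite -scaleN1r (lin_scale fL) scaleN1r. Qed.

Lemma lin_sub V W (f : V -> W) : linear f -> {morph f : x y / x - y}.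
Proof. by move=> fL x y; rewrite (lin_add fL) (lin_opp fL). Qed.

Lemma lin_sum V W (f : V -> W) (I : Type) (s : seq I) (P : pred I) (F : I -> V) :
  linear f -> f (\sum_(i <- s | P i) F i) = \sum_(i <- s | P i) f (F i).
Proof. by move=> fL; apply: (big_morph f (lin_add fL) (lin_zero fL)). Qed.

Lemma lin_comp U V W (f : V -> W) (g : U -> V) :
  linear f -> linear g -> linear (fun x => f (g x)).
Proof. by move=> fL gL c x y; rewrite gL fL. Qed.

Definition finite_dimensional V :=
  exists (n : nat) (b : 'rV[k]_n -> V), linear b /\ forall x, exists u, b u = x.

(** The kernel of [b] is the row space of some matrix [K]. The matrix [p] kills that row space and
    satisfies [b (u *m p) = b u], so any set-theoretic section becomes linear after multiplication
    by [p]. *)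
Lemma finite_dimensional_section V n (b : 'rV[k]_n -> V) :
  linear b -> (forall x, exists u, b u = x) ->
  exists a : V -> 'rV[k]_n, linear a /\ cancel a b.
Proof.
move=> bL b_surj.
pose in_ker (K : 'M[k]_n) := forall v, (v <= K)%MS -> b v = 0.
have [K K_ker K_max] : exists2 K, in_ker K & forall v, b v = 0 -> (v <= K)%MS.
  have ker0 : in_ker 0 by move=> v; rewrite submx0 => /eqP ->; apply: lin_zero.
  (* Induction on the corank: a vector of the kernel of [b] outside [K] raises the rank when
     adjoined. *)
  have step m (K : 'M[k]_n) : in_ker K -> (n - \rank K <= m)%N ->
      exists2 K', in_ker K' & forall v, b v = 0 -> (v <= K')%MS.
    elim: m K => [|m IHm] K K_ker rK.
      exists K => // v _; rewrite (@submx_full _ _ _ _ _ K) // /row_full.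
      by rewrite eqn_leq rank_leq_col -subn_eq0 -leqn0.
    have [K_max|] := pselect (forall v, b v = 0 -> (v <= K)%MS); first by exists K.
    move=> /existsNP [v /not_implyP [bv /negP vK]].
    apply: (IHm (v + K)%MS) => [w /sub_addsmxP [[x y] /= ->]|].
      rewrite (lin_add bL) (K_ker _ (submxMl _ _)) addr0.
      by rewrite [x]mx11_scalar mul_scalar_mx (lin_scale bL) bv scaler0.
    have: (\rank K < \rank (v + K)%MS)%N.
      by apply: rank_ltmx; rewrite ltmxE addsmxSr addsmx_sub negb_and vK.
    have := rank_leq_col (v + K)%MS; move: rK; rewrite !leq_subLR.
    move=> h1 h2 h3; apply: (leq_trans h1).
    by rewrite -addSnnS leq_add2r.
  exact: (step n 0 ker0 (leq_subr _ _)).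
pose p : 'M[k]_n := 1%:M - pinvmx K *m K.
have bp u : b (u *m p) = b u.
  rewrite mulmxBr mulmx1 (lin_sub bL) mulmxA.
  by rewrite (K_ker (u *m pinvmx K *m K)) ?subr0 // submxMl.
have p0 v : b v = 0 -> v *m p = 0.
  by move=> /K_max vK; rewrite mulmxBr mulmx1 mulmxA mulmxKpV // subrr.
have [a aP] := choice b_surj.
exists (fun x => a x *m p); split=> [c x y|x]; last by rewrite bp.
apply/eqP; rewrite scalemxAl -mulmxDl -subr_eq0 -mulmxBl; apply/eqP/p0.
by rewrite (lin_sub bL) bL !aP subrr.
Qed.

(** The pseudo-inverse of the matrix of [d] does it; this replaces a choice of complements of kernel
    and image. *)
Lemma lin_regular V W (d : V -> W) :
  finite_dimensional V -> finite_dimensional W -> linear d ->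
  exists e : W -> V, linear e /\ forall x, d (e (d x)) = d x.
Proof.
move=> [m [bV [bVL bV_surj]]] [n [bW [bWL bW_surj]]] dL.
have [a [aL aK]] := finite_dimensional_section bWL bW_surj.
pose D : 'M[k]_(m, n) := \matrix_i a (d (bV (delta_mx 0 i))).
have DE v : a (d (bV v)) = v *m D.
  rewrite {1}[v]row_sum_delta mulmx_sum_row.
  rewrite (lin_sum _ _ _ bVL) (lin_sum _ _ _ dL) (lin_sum _ _ _ aL).
  by apply: eq_bigr => i _; rewrite (lin_scale bVL) (lin_scale dL) (lin_scale aL) rowK.
exists (fun w => bV (a w *m pinvmx D)); split=> [c x y|x].
  by rewrite aL mulmxDl -scalemxAl bVL.
have [v <-] := bV_surj x; apply: (can_inj aK).
by rewrite !DE mulmxKpV // submxMl.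
Qed.

(** With [e] a generalised inverse of [d], [y - e (d y)] lies in the kernel of [d], hence in the
    image of [d'], where a generalised inverse of [d'] is a section. *)
Lemma split_exact U V W (d' : U -> V) (d : V -> W) :
  finite_dimensional U -> finite_dimensional V -> finite_dimensional W ->
  linear d' -> linear d ->
  (forall y, d y = 0 -> exists x, d' x = y) ->
  exists (e : W -> V) (e' : V -> U),
    [/\ linear e, linear e' & forall y, e (d y) + d' (e' y) = y].
Proof.
move=> fU fV fW d'L dL ex.
have [e [eL eK]] := lin_regular fV fW dL.
have [e' [e'L e'K]] := lin_regular fU fV d'L.
exists e, (fun y => e' (y - e (d y))); split=> // [c x y|y].
  by rewrite dL eL -e'L scalerBr opprD addrACA.
have [|x xE] := ex (y - e (d y)); first by rewrite (lin_sub dL) eK subrr.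
by rewrite -xE e'K xE addrC subrK.
Qed.

End FiniteDimension.

Lemma dependent_choice (I : Type) (F : I -> Type) (P : forall i, F i -> Prop) :
  (forall i, exists w, P i w) -> exists w : forall i, F i, forall i, P i (w i).
Proof.
by move=> H; exists (fun i => projT1 (cid (H i))) => i; case: cid.
Qed.

(* The invariant [J] is what allows a one-sided choice to be continued in the
   direction of the other end of the integer line. *)
Lemma int_chain (W : int -> Type) (J : forall n, W n -> Prop)
    (R : forall m n, W m -> W n -> Prop) :
  (exists n (w : W n), J n w) ->
  (forall m n (w : W m), n = m + 1 -> J m w -> exists w', J n w' /\ R m n w w') ->
  (forall m n (w : W n), n = m + 1 -> J n w -> exists w', J m w' /\ R m n w' w) ->
  exists w : forall n, W n, forall m n, n = m + 1 -> R m n (w m) (w n).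
Proof.
move=> [n0 start] up down.
have [w0 Jw0] : exists w : W 0, J 0 w.
  elim/int_rect: n0 start => [//|n IHn|n IHn] [w Jw]; apply: IHn.
    have [|w' [Jw' _]] := down n%:Z _ w _ Jw; last by exists w'.
    by rewrite -PoszD addn1.
  have [|w' [Jw' _]] := up _ (- n%:Z) w _ Jw; last by exists w'.
  by rewrite -addn1 PoszD opprD subrK.
pose S n := {w : W n | J n w}.
have nextP m (w : S m) : exists w' : S (m + 1), R m (m + 1) (sval w) (sval w').
  case: w => w Jw; have [w' [Jw' Rw']] := up _ _ w erefl Jw.
  by exists (exist _ w' Jw').
have prevP m (w : S (m + 1)) : exists w' : S m, R m (m + 1) (sval w') (sval w).
  case: w => w Jw; have [w' [Jw' Rw']] := down _ _ w erefl Jw.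
  by exists (exist _ w' Jw').
pose next m w := projT1 (cid (@nextP m w)).
pose prev m w := projT1 (cid (@prevP m w)).
have posS (n : nat) : n%:Z + 1 = n.+1 by rewrite -PoszD addn1.
have negS (n : nat) : Negz n = Negz n.+1 + 1.
  by rewrite !NegzE -[n.+2]addn1 PoszD opprD subrK.
(* As [Negz n] is -(n + 1), the negative branch starts in degree -1, one step below [wpos 0]. *)
pose fix wpos (n : nat) : S n :=
  if n is n'.+1 then ecast m (S m) (posS n') (next _ (wpos n'))
  else exist _ w0 Jw0.
pose fix wneg (n : nat) : S (Negz n) :=
  if n is n'.+1 then prev _ (ecast m (S m) (negS n') (wneg n'))
  else prev (Negz 0) (wpos 0).
exists (fun n => sval (match n as n return S n with Posz n => wpos n | Negz n => wneg n end)).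
have castl m n (H : m + 1 = n) (w : S m) (w' : S (m + 1)) :
    R m (m + 1) (sval w) (sval w') -> R m n (sval w) (sval (ecast i (S i) H w')).
  by case: n / H.
have castr m n (H : n = m + 1) (w : S m) (w' : S n) :
    R m (m + 1) (sval w) (sval (ecast i (S i) H w')) -> R m n (sval w) (sval w').
  by move: w'; case: _ / H.
move=> [m|[|m]] n nE.
- have {nE} -> : n = Posz m.+1 by rewrite nE posS.
  by apply: castl; rewrite /next; case: cid.
- have {nE} -> : n = 0 by rewrite nE.
  by rewrite /= /prev; case: cid.
have {nE} -> : n = Negz m by rewrite nE negS.
by apply: castr (negS m) _ _ _; rewrite /= /prev; case: cid.
Qed.

(** * Null-homotopies *)

Section NullHomotopy.
Variables (k : fieldType) (A : falgType k).

Lemma hom_subE (M N : bimodule A) (f g : bimod_hom M N) x :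
  (f - g) x = f x - g x.
Proof. by rewrite homDE -scaleN1r homZE scaleN1r. Qed.

Lemma homB (M N : bimodule A) (f : bimod_hom M N) x y : f (x - y) = f x - f y.
Proof. exact: (lin_sub (hom_linear f)). Qed.

(** This is acyclicity of the complex Hom(P, Y), and [cocycles_extend] is that of Hom(T, Q). *)
Definition cycles_lift (P : bimodule A) (Y : complex A) :=
  forall (i j : int) (H : i = j + 1) (f : bimod_hom P (Y j)),
    (forall (l : int) (H' : j = l + 1) x, diff Y H' (f x) = 0) ->
    exists f' : bimod_hom P (Y i), forall x, diff Y H (f' x) = f x.

Definition cocycles_extend (T : complex A) (Q : bimodule A) :=
  forall (i j : int) (H : i = j + 1) (f : bimod_hom (T i) Q),
    (forall (l : int) (H' : l = i + 1) x, f (diff T H' x) = 0) ->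
    exists f' : bimod_hom (T j) Q, forall x, f' (diff T H x) = f x.

(* The values of [g] and [s] matter only in the degrees bound by the equation
   on [n], [p] and [q]; indexing them by all pairs of degrees avoids transport. *)
Lemma null_homotopy (T Y : complex A) (p : int) (c : k)
    (g : forall n q : int, bimod_hom (T n) (Y q)) :
  c != 0 ->
  (forall n, cycles_lift (T n) Y) -> (forall q, cocycles_extend T (Y q)) ->
  (forall n m q l (Hn : n = m + 1) (Hq : q = l + 1), n = p + q ->
     forall x, g m l (diff T Hn x) = c *: diff Y Hq (g n q x)) ->
  (exists n m q l (Hn : n = m + 1) (Hq : q = l + 1)
     (w : bimod_hom (T m) (Y q)), n = p + q /\
     forall x, diff Y Hq (g n q x) = diff Y Hq (w (diff T Hn x))) ->
  exists s : forall n q, bimod_hom (T n) (Y q),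
    forall n m q q' (Hn : n = m + 1) (Hq : q' = q + 1), n = p + q ->
    forall x, g n q x = c *: diff Y Hq (s n q' x) + s m q (diff T Hn x).
Proof.
move=> c0 lift ext gd start.
(* [J] is the homotopy equation in degree [q] after applying the differential of [Y], which removes
   the next component of the homotopy. *)
pose J q (w : forall n, bimod_hom (T n) (Y q)) :=
  forall n m l (Hn : n = m + 1) (Hq : q = l + 1), n = p + q ->
  forall x, diff Y Hq (g n q x) = diff Y Hq (w m (diff T Hn x)).
pose R q q' (w : forall n, bimod_hom (T n) (Y q))
    (w' : forall n, bimod_hom (T n) (Y q')) :=
  forall n m (Hn : n = m + 1) (Hq : q' = q + 1), n = p + q ->
  forall x, g n q x = c *: diff Y Hq (w' n x) + w m (diff T Hn x).
have [|q q' w qq' Jw|l q w ql Jw|s sR] := int_chain (J := J) (R := R).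
- have [n [m [q [l [Hn [Hq [w [nE wP]]]]]]]] := start; exists q.
  have /dependent_choice[w' w'P] i : exists w' : bimod_hom (T i) (Y q),
      forall n' l' (Hn' : n' = i + 1) (Hq' : q = l' + 1), n' = p + q ->
      forall x, diff Y Hq' (g n' q x) = diff Y Hq' (w' (diff T Hn' x)).
    have [im|im] := pselect (i = m); last first.
      exists 0 => n' l' Hn' Hq' nE'; case: im.
      by apply: (addIr 1); rewrite -Hn' nE' -nE.
    subst i; exists w => n' l' Hn' Hq' nE' x.
    have ll : l' = l by apply: (addIr 1); rewrite -Hq' -Hq.
    have nn : n' = n by rewrite Hn' -Hn.
    move: Hn' Hq' x; rewrite {l'}ll {n' nE'}nn => Hn' Hq' x.
    by rewrite (Prop_irrelevance Hq' Hq) (Prop_irrelevance Hn' Hn) wP.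
  by exists w' => n' m' l' Hn' Hq' nE' x; apply: w'P.
- have /dependent_choice[w' w'P] n : exists w' : bimod_hom (T n) (Y q'),
      forall m (Hn : n = m + 1), n = p + q ->
      forall x, c *: diff Y qq' (w' x) = g n q x - w m (diff T Hn x).
    have [nE|nN] := pselect (n = p + q); last by exists 0.
    have nm : n = n - 1 + 1 by rewrite subrK.
    (* By [J], the map [g - w d] takes values in the cycles of [Y]. *)
    have [l Hl x|w' w'P] := lift n _ _ qq'
        (c^-1 *: (g n q - hom_comp (w (n - 1)) (diff T nm))).
      by rewrite homZE hom_subE homZ homD homN /= (Jw n _ l nm Hl) // subrr scaler0.
    exists w' => m Hn _ x; rewrite w'P homZE hom_subE scalerA divff // scale1r /=.
    have mE : n - 1 = m by rewrite Hn addrK.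
    by subst m; rewrite (Prop_irrelevance nm Hn).
  exists w'; split=> [n m l Hn Hq nE x|n m Hn Hq nE x]; last first.
    by rewrite (Prop_irrelevance Hq qq') (w'P n m Hn) // subrK.
  have lq : l = q by apply: (addIr 1); rewrite -Hq -qq'.
  subst l; rewrite (Prop_irrelevance Hq qq').
  have mE : m = p + q by apply: (addIr 1); rewrite -Hn nE qq' addrA.
  have Hm : m = m - 1 + 1 by rewrite subrK.
  apply: (scalerI c0); rewrite -(gd n m q' q Hn qq') //.
  by rewrite (w'P m (m - 1) Hm mE) diffK hom0 subr0.
- have /dependent_choice[w' w'P] m : exists w' : bimod_hom (T m) (Y l),
      forall n (Hn : n = m + 1), n = p + l ->
      forall x, w' (diff T Hn x) = g n l x - c *: diff Y ql (w n x).
    have [mE|mN] := pselect (m + 1 = p + l); last first.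
      by exists 0 => n Hn nE; case: mN; rewrite -Hn.
    (* The map [g - c d w] kills the boundaries of [T]: its two terms agree on them by [gd] and
       [J]. *)
    have [i Hi x|w' w'P] := ext l (m + 1) m erefl
       (g (m + 1) l - c *: hom_comp (diff Y ql) (w (m + 1))).
      have iE : i = p + q by rewrite Hi mE ql addrA.
      by rewrite hom_subE homZE /= (gd i _ q l Hi ql) // (Jw i _ l Hi) // subrr.
    by exists w' => n Hn _ x; subst n; rewrite w'P hom_subE homZE.
  exists w'; split=> [n m i Hn Hl nE x|n m Hn Hq nE x].
    by rewrite (w'P m n Hn nE) homD homN homZ diffK scaler0 subr0.
  by rewrite (Prop_irrelevance Hq ql) (w'P m n Hn nE) addrC subrK.
by exists (fun n q => s q n) => n m q q' Hn Hq nE x; apply: (sR q q').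
Qed.

End NullHomotopy.

(** * Casimir elements and traces *)

Section Casimir.
Variables (k : fieldType) (A : falgType k).

(* The last clause says that [\sum_i x i (x) y i] is a Casimir element:
   [\sum_i a * x i (x) y i = \sum_i x i (x) y i * a]. *)
Definition casimir n (x y : 'I_n -> A) (t : A -> k^o) :=
  [/\ linear t, \sum_i t (y i) *: x i = 1, \sum_i t (x i) *: y i = 1 &
    forall (V : lmodType k) (F : A -> A -> V),
      (forall b, linear (F^~ b)) -> (forall a, linear (F a)) ->
      forall a, \sum_i F (a * x i) (y i) = \sum_i F (x i) (y i * a)].

(** Take a basis [x], its dual basis [y] for the form [B], and [t = B(-, 1)]. The coefficient of
    [x j] in [a * x i] and that of [y i] in [y j * a] are both [B (y j * a) (x i)], which gives the
    Casimir identity. *)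
Lemma Frobenius_casimir : Frobenius A ->
  exists n (x y : 'I_n -> A) (t : A -> k^o), casimir x y t.
Proof.
case=> B [[Br Bl] [ndl ndr] Bassoc].
pose n := \dim {: A}; pose x (i : 'I_n) := (vbasis {: A})`_i.
have xP a : a = \sum_i coord (vbasis {: A}) i a *: x i.
  exact: coord_vbasis (memvf a).
have eqB a b : (forall i, B a (x i) = B b (x i)) -> a = b.
  move=> ab; apply/eqP; rewrite -subr_eq0; apply/eqP/ndl => c.
  rewrite (xP c) (lin_sum _ _ _ (Br _)) big1 // => i _.
  by rewrite (lin_scale (Br _)) (lin_sub (Bl _)) ab subrr scaler0.
pose G : 'M[k]_n := \matrix_(i, j) B (x i) (x j).
have Gu : G \in unitmx.
  rewrite -row_free_unit; apply: inj_row_free => u uG.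
  have u0 : \sum_i u 0 i *: x i = 0.
    apply: eqB => j; rewrite (lin_sum _ _ _ (Bl _)) (lin_zero (Bl (x j))).
    transitivity ((u *m G) 0 j); last by rewrite uG mxE.
    by rewrite mxE; apply: eq_bigr => i _; rewrite (lin_scale (Bl _)) mxE.
  apply/rowP => i; rewrite mxE.
  have /freeP := basis_free (vbasisP {: A}).
  exact.
pose y i := \sum_j invmx G i j *: x j.
have yx i j : B (y i) (x j) = (i == j)%:R.
  rewrite (lin_sum _ _ _ (Bl _)).
  transitivity ((invmx G *m G) i j); last by rewrite mulVmx // mxE.
  by rewrite mxE; apply: eq_bigr => l _; rewrite (lin_scale (Bl _)) mxE.
have xB a : \sum_i B (y i) a *: x i = a.
  rewrite [RHS]xP; apply: eq_bigr => i _; congr (_ *: _).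
  rewrite {1}(xP a) (lin_sum _ _ _ (Br _)) (bigD1 i) //= big1 => [|j ji].
    by rewrite (lin_scale (Br _)) yx eqxx addr0 /= [_ *: _]mulr1.
  by rewrite (lin_scale (Br _)) yx eq_sym (negPf ji) scaler0.
have yB a : \sum_i B a (x i) *: y i = a.
  apply: eqB => j; rewrite (lin_sum _ _ _ (Bl _)) (bigD1 j) //= big1 => [|i ij].
    by rewrite (lin_scale (Bl _)) yx eqxx addr0 /= [_ *: _]mulr1.
  by rewrite (lin_scale (Bl _)) yx (negPf ij) scaler0.
exists n, x, y, (B^~ 1); split; [exact: Bl|exact: xB| |].
  rewrite -[RHS]yB; apply: eq_bigr => i _; congr (_ *: _).
  by rewrite -[in RHS](mulr1 (x i)) -Bassoc mul1r.
move=> V F Fl Fr a.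
transitivity (\sum_i \sum_j B (y j * a) (x i) *: F (x j) (y i)).
  apply: eq_bigr => i _; rewrite -{1}(xB (a * x i)) (lin_sum _ _ _ (Fl _)).
  by apply: eq_bigr => j _; rewrite (lin_scale (Fl _)) Bassoc.
rewrite exchange_big; apply: eq_bigr => j _ /=.
rewrite -{2}(yB (y j * a)) (lin_sum _ _ _ (Fr _)).
by apply: eq_bigr => i _; rewrite (lin_scale (Fr _)).
Qed.

End Casimir.

Section Trace.
Variables (k : fieldType) (A : falgType k).
Variables (n : nat) (x y : 'I_n -> A) (t : A -> k^o).
Hypothesis xyP : casimir x y t.
Implicit Types P Q : bimodule A.

(** One-sided averages over the Casimir element: [ltrace] makes a linear map commute with the left
    action, [rtrace] with the right one. *)
Definition ltrace P Q (h : P -> Q) (m : P) : Q :=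
  \sum_i lact (x i) (h (lact (y i) m)).
Definition rtrace P Q (h : P -> Q) (m : P) : Q :=
  \sum_i ract (h (ract m (x i))) (y i).

Lemma lact_sum P (I : Type) (s : seq I) (p : pred I) (F : I -> P) a :
  lact a (\sum_(i <- s | p i) F i) = \sum_(i <- s | p i) lact a (F i).
Proof. exact: lin_sum (lact_linearr a). Qed.
Lemma ract_sum P (I : Type) (s : seq I) (p : pred I) (F : I -> P) a :
  ract (\sum_(i <- s | p i) F i) a = \sum_(i <- s | p i) ract (F i) a.
Proof. exact: (lin_sum _ _ _ (ract_linearl a)). Qed.

Section OneMap.
Variables (P Q : bimodule A) (h : P -> Q).
Hypothesis hL : linear h.

Lemma ltrace_linear : linear (ltrace h).
Proof.
move=> c u v; rewrite /ltrace scaler_sumr -big_split; apply: eq_bigr => i _ /=.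
by rewrite lact_linearr hL lact_linearr.
Qed.
Lemma rtrace_linear : linear (rtrace h).
Proof.
move=> c u v; rewrite /rtrace scaler_sumr -big_split; apply: eq_bigr => i _ /=.
by rewrite ract_linearl hL ract_linearl.
Qed.

Lemma ltrace_lact a m : ltrace h (lact a m) = lact a (ltrace h m).
Proof.
have [_ _ _ xy] := xyP; rewrite /ltrace lact_sum.
transitivity (\sum_i lact (x i) (h (lact (y i * a) m))).
  by apply: eq_bigr => i _; rewrite lactM.
rewrite -(xy Q (fun b c => lact b (h (lact c m)))) => [|b|b].
- by apply: eq_bigr => i _; rewrite lactM.
- exact: lact_linearl.
- by move=> c u v; rewrite lact_linearl hL lact_linearr.
Qed.
Lemma rtrace_ract m a : rtrace h (ract m a) = ract (rtrace h m) a.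
Proof.
have [_ _ _ xy] := xyP; rewrite /rtrace ract_sum.
transitivity (\sum_i ract (h (ract m (a * x i))) (y i)).
  by apply: eq_bigr => i _; rewrite ractM.
rewrite (xy Q (fun b c => ract (h (ract m b)) c)) => [|b|b].
- by apply: eq_bigr => i _; rewrite ractM.
- by move=> c u v; rewrite ract_linearr hL ract_linearl.
- exact: ract_linearr.
Qed.

Lemma ltrace_ract :
  (forall m a, h (ract m a) = ract (h m) a) ->
  forall m a, ltrace h (ract m a) = ract (ltrace h m) a.
Proof.
move=> hR m a; rewrite /ltrace ract_sum; apply: eq_bigr => i _.
by rewrite -lractA hR lractA.
Qed.

End OneMap.

Definition trace P Q (h : P -> Q) : P -> Q := ltrace (rtrace h).

Definition trace_hom P Q (h : P -> Q) (hL : linear h) : bimod_hom P Q :=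
  BimodHom (ltrace_linear (rtrace_linear hL)) (ltrace_lact (rtrace_linear hL))
    (ltrace_ract (rtrace_ract hL)).

Lemma trace_compl P Q Q' (f : bimod_hom Q Q') (h : P -> Q) m :
  trace (fun z => f (h z)) m = f (trace h m).
Proof.
rewrite /trace /ltrace /rtrace (lin_sum _ _ _ (hom_linear f)).
apply: eq_bigr => i _; rewrite hom_lact (lin_sum _ _ _ (hom_linear f)).
by congr lact; apply: eq_bigr => j _; rewrite hom_ract.
Qed.

Lemma trace_compr P P' Q (f : bimod_hom P P') (h : P' -> Q) m :
  trace (fun z => h (f z)) m = trace h (f m).
Proof.
rewrite /trace /ltrace /rtrace; apply: eq_bigr => i _; congr lact.
by apply: eq_bigr => j _; rewrite hom_ract hom_lact.
Qed.

Lemma eq_trace P Q (h h' : P -> Q) m : h =1 h' -> trace h m = trace h' m.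
Proof. by move=> /funext ->. Qed.

(* Higman's criterion. *)
Definition trace_split P := exists2 h : P -> P, linear h & forall m, trace h m = m.

(** [f'] is the trace of [e f h]. Bimodule maps move out of a trace, so [D f'] is the trace of
    [D e f h], which is that of [f h], that is [f]. *)
Lemma trace_lift P Y Z (f : bimod_hom P Y) (D : bimod_hom Z Y) (e : Y -> Z) :
  trace_split P -> linear e -> (forall m, D (e (f m)) = f m) ->
  exists f' : bimod_hom P Z, forall m, D (f' m) = f m.
Proof.
move=> [h hL hP] eL De.
exists (trace_hom (lin_comp eL (lin_comp (hom_linear f) hL))) => m /=.
rewrite -(trace_compl D (fun z => e (f (h z)))).
rewrite (@eq_trace _ _ _ (fun z => f (h z))) => [|z]; last by rewrite De.
by rewrite trace_compl hP.
Qed.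

(** Dually, [f'] is the trace of [h f e], with [h] splitting the target [Y]. *)
Lemma trace_extend P P' Y (f : bimod_hom P Y) (D : bimod_hom P P') (e : P' -> P) :
  trace_split Y -> linear e -> (forall m, f (e (D m)) = f m) ->
  exists f' : bimod_hom P' Y, forall m, f' (D m) = f m.
Proof.
move=> [h hL hP] eL De.
exists (trace_hom (lin_comp hL (lin_comp (hom_linear f) eL))) => m.
rewrite -[LHS]/(trace (fun z => h (f (e z))) (D m)).
rewrite -(trace_compr D (fun z => h (f (e z)))).
rewrite (@eq_trace _ _ _ (fun z => h (f z))) => [|z]; last by rewrite De.
by rewrite trace_compr hP.
Qed.

(** The two sides are kept apart because in a tensor product over [A] the left action comes from the
    first factor and the right action from the second. *)
Definition ltrace_split P := exists h : P -> P,
  [/\ linear h, forall m a, h (ract m a) = ract (h m) a & forall m, ltrace h m = m].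
Definition rtrace_split P := exists h : P -> P,
  [/\ linear h, forall a m, h (lact a m) = lact a (h m) & forall m, rtrace h m = m].

(** The splitting is [f g]: as [f] is right linear, it moves out of the right average, which turns
    [g] into the identity and leaves the left average of [f]. *)
Lemma lrtrace_split P : ltrace_split P -> rtrace_split P -> trace_split P.
Proof.
move=> [f [fL fR fP]] [g [gL _ gP]]; exists (fun m => f (g m)); first exact: lin_comp.
move=> m; rewrite -[RHS]fP /trace; congr (ltrace _ _); apply/funext => {}m.
rewrite /rtrace -[in RHS](gP m) /rtrace (lin_sum _ _ _ fL).
by apply: eq_bigr => i _; rewrite fR.
Qed.

End Trace.

(** * Projective bimodules *)

Section LinearFunctions.
Variables (k : fieldType) (U V : lmodType k).

Record linfun := Linfun { linfun_fun :> U -> V; linfunP : linear linfun_fun }.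

HB.instance Definition _ := gen_eqMixin linfun.
HB.instance Definition _ := gen_choiceMixin linfun.

Lemma linfun_ext (f g : linfun) : f =1 g -> f = g.
Proof.
case: f g => [f fL] [g gL] /= /funext fg.
by subst g; congr Linfun; apply: Prop_irrelevance.
Qed.

Fact linfun_zeroP : linear (fun _ : U => 0 : V).
Proof. by move=> c u v; rewrite scaler0 addr0. Qed.
Fact linfun_addP (f g : linfun) : linear (fun u => f u + g u).
Proof. by move=> c u v; rewrite !linfunP scalerDr addrACA. Qed.
Fact linfun_scaleP c (f : linfun) : linear (fun u => c *: f u).
Proof. by move=> d u v; rewrite linfunP scalerDr !scalerA mulrC. Qed.

Let linfun_add f g := Linfun (linfun_addP f g).
Let linfun_scale c f := Linfun (linfun_scaleP c f).

Fact linfun_addA : associative linfun_add.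
Proof. by move=> f g h; apply: linfun_ext => u /=; rewrite addrA. Qed.
Fact linfun_addC : commutative linfun_add.
Proof. by move=> f g; apply: linfun_ext => u /=; rewrite addrC. Qed.
Fact linfun_add0 : left_id (Linfun linfun_zeroP) linfun_add.
Proof. by move=> f; apply: linfun_ext => u /=; rewrite add0r. Qed.
Fact linfun_addN :
  left_inverse (Linfun linfun_zeroP) (linfun_scale (-1)) linfun_add.
Proof. by move=> f; apply: linfun_ext => u /=; rewrite scaleN1r addNr. Qed.

HB.instance Definition _ := GRing.isZmodule.Build linfun
  linfun_addA linfun_addC linfun_add0 linfun_addN.

Fact linfun_scaleA a b f : linfun_scale a (linfun_scale b f) = linfun_scale (a * b) f.
Proof. by apply: linfun_ext => u /=; rewrite scalerA. Qed.
Fact linfun_scale1 : left_id 1 linfun_scale.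
Proof. by move=> f; apply: linfun_ext => u /=; rewrite scale1r. Qed.
Fact linfun_scaleDr : right_distributive linfun_scale +%R.
Proof. by move=> a f g; apply: linfun_ext => u /=; rewrite scalerDr. Qed.
Fact linfun_scaleDl f : {morph linfun_scale^~ f : a b / a + b}.
Proof. by move=> a b; apply: linfun_ext => u /=; rewrite scalerDl. Qed.

HB.instance Definition _ := GRing.Zmodule_isLmodule.Build k linfun
  linfun_scaleA linfun_scale1 linfun_scaleDr linfun_scaleDl.

End LinearFunctions.

Section Coinduced.
Variables (k : fieldType) (A : falgType k) (P : bimodule A).
Local Notation H := (linfun A P).

Fact coindl_lactP a (f : H) : linear (fun b => f (b * a)).
Proof. by move=> c u v; rewrite mulrDl -scalerAl linfunP. Qed.
Fact coindl_ractP (f : H) a : linear (fun b => ract (f b) a).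
Proof. by move=> c u v; rewrite linfunP ract_linearl. Qed.

(* [Hom_k(A, P)] stands for the cover A (x)_k P of P by way of the Frobenius
   form: a projective P is a direct summand of it. *)
Definition coindl : bimodule A.
Proof.
apply: (@Bimodule k A H (fun a f => Linfun (coindl_lactP a f))
  (fun f a => Linfun (coindl_ractP f a))).
- by move=> f c a b; apply: linfun_ext => u /=; rewrite mulrDr -scalerAr linfunP.
- by move=> a c f g; apply: linfun_ext.
- by move=> a c f g; apply: linfun_ext => u /=; rewrite ract_linearl.
- by move=> f c a b; apply: linfun_ext => u /=; rewrite ract_linearr.
- by move=> f; apply: linfun_ext => u /=; rewrite mulr1.
- by move=> a b f; apply: linfun_ext => u /=; rewrite mulrA.
- by move=> f; apply: linfun_ext => u /=; rewrite ract1.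
- by move=> f a b; apply: linfun_ext => u /=; rewrite ractM.
- by move=> a f b; apply: linfun_ext.
Defined.

Fact coindr_lactP a (f : H) : linear (fun b => lact a (f b)).
Proof. by move=> c u v; rewrite linfunP lact_linearr. Qed.
Fact coindr_ractP (f : H) a : linear (fun b => f (a * b)).
Proof. by move=> c u v; rewrite mulrDr -scalerAr linfunP. Qed.

Definition coindr : bimodule A.
Proof.
apply: (@Bimodule k A H (fun a f => Linfun (coindr_lactP a f))
  (fun f a => Linfun (coindr_ractP f a))).
- by move=> f c a b; apply: linfun_ext => u /=; rewrite lact_linearl.
- by move=> a c f g; apply: linfun_ext => u /=; rewrite lact_linearr.
- by move=> a c f g; apply: linfun_ext.
- by move=> f c a b; apply: linfun_ext => u /=; rewrite mulrDl -scalerAl linfunP.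
- by move=> f; apply: linfun_ext => u /=; rewrite lact1.
- by move=> a b f; apply: linfun_ext => u /=; rewrite lactM.
- by move=> f; apply: linfun_ext => u /=; rewrite mul1r.
- by move=> f a b; apply: linfun_ext => u /=; rewrite mulrA.
- by move=> a f b; apply: linfun_ext.
Defined.

Variables (n : nat) (x y : 'I_n -> A) (t : A -> k^o).
Hypothesis xyP : casimir x y t.

(** With [f] read as the sum of the tensors [x i (x) f (y i)], this is the action map from A (x)_k P
    to P. *)
Definition coindl_sum (f : coindl) : P := \sum_i lact (x i) ((f : H) (y i)).

Fact coindl_sum_linear : linear coindl_sum.
Proof.
move=> c f g; rewrite /coindl_sum scaler_sumr -big_split; apply: eq_bigr => i _ /=.
by rewrite lact_linearr.
Qed.
Fact coindl_sum_lact a f : coindl_sum (lact a f) = lact a (coindl_sum f).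
Proof.
have [_ _ _ xy] := xyP; rewrite /coindl_sum lact_sum /=.
rewrite -(xy P (fun b c => lact b ((f : H) c))) => [|b|b].
- by apply: eq_bigr => i _; rewrite lactM.
- exact: lact_linearl.
- by move=> c u v; rewrite linfunP lact_linearr.
Qed.
Fact coindl_sum_ract f a : coindl_sum (ract f a) = ract (coindl_sum f) a.
Proof. by rewrite /coindl_sum ract_sum; apply: eq_bigr => i _ /=; rewrite lractA. Qed.

(** The function [t a *: m] of [a] is sent to [m], so [coindl_sum] is onto and has a bimodule
    section [s]. Evaluating [s m] at 1 gives the splitting: its left average is
    [coindl_sum (s m)]. *)
Lemma projective_ltrace_split : projective P -> ltrace_split x y P.
Proof.
move=> Pproj; have [tL tx _ _] := xyP.
have surj m : exists f, coindl_sum f = m.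
  have mL : linear (fun a => t a *: m).
    by move=> c u v; rewrite tL scalerDl scalerA.
  exists (Linfun mL); rewrite /coindl_sum /= -[RHS]lact1 -tx.
  rewrite (lin_sum _ _ _ (lact_linearl m)).
  by apply: eq_bigr => i _; rewrite lactZr lactZl.
have [s sP] := Pproj _ _ (BimodHom coindl_sum_linear coindl_sum_lact coindl_sum_ract)
  (hom_id P) surj.
have sE m : coindl_sum (s m) = m by rewrite -[RHS]/(hom_id P m) -sP.
exists (fun m => (s m : H) 1); split=> [c u v|m a|m].
- by rewrite homD homZ.
- by rewrite hom_ract.
- rewrite -[RHS]sE; apply: eq_bigr => i _.
  by rewrite hom_lact /= mul1r.
Qed.

Definition coindr_sum (f : coindr) : P := \sum_i ract ((f : H) (x i)) (y i).

Fact coindr_sum_linear : linear coindr_sum.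
Proof.
move=> c f g; rewrite /coindr_sum scaler_sumr -big_split; apply: eq_bigr => i _ /=.
by rewrite ract_linearl.
Qed.
Fact coindr_sum_lact a f : coindr_sum (lact a f) = lact a (coindr_sum f).
Proof. by rewrite /coindr_sum lact_sum; apply: eq_bigr => i _ /=; rewrite lractA. Qed.
Fact coindr_sum_ract f a : coindr_sum (ract f a) = ract (coindr_sum f) a.
Proof.
have [_ _ _ xy] := xyP; rewrite /coindr_sum ract_sum /=.
rewrite (xy P (fun b c => ract ((f : H) b) c)) => [|b|b].
- by apply: eq_bigr => i _; rewrite ractM.
- by move=> c u v; rewrite linfunP ract_linearl.
- exact: ract_linearr.
Qed.

Lemma projective_rtrace_split : projective P -> rtrace_split x y P.
Proof.
move=> Pproj; have [tL _ ty _] := xyP.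
have surj m : exists f, coindr_sum f = m.
  have mL : linear (fun a => t a *: m).
    by move=> c u v; rewrite tL scalerDl scalerA.
  exists (Linfun mL); rewrite /coindr_sum /= -[RHS]ract1 -ty.
  rewrite (lin_sum _ _ _ (ract_linearr m)).
  by apply: eq_bigr => i _; rewrite ractZl ractZr.
have [s sP] := Pproj _ _ (BimodHom coindr_sum_linear coindr_sum_lact coindr_sum_ract)
  (hom_id P) surj.
have sE m : coindr_sum (s m) = m by rewrite -[RHS]/(hom_id P m) -sP.
exists (fun m => (s m : H) 1); split=> [c u v|a m|m].
- by rewrite homD homZ.
- by rewrite hom_lact.
- rewrite -[RHS]sE; apply: eq_bigr => i _.
  by rewrite hom_ract /= mulr1.
Qed.

Lemma projective_trace_split : projective P -> trace_split x y P.
Proof.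
move=> Pproj; apply: lrtrace_split; first exact: projective_ltrace_split.
exact: projective_rtrace_split.
Qed.

End Coinduced.

(** * Tensor products *)

Section TensorSplit.
Variables (k : fieldType) (A : falgType k).
Variables (n : nat) (x y : 'I_n -> A) (t : A -> k^o).
Hypothesis xyP : casimir x y t.
Implicit Types P Q X : bimodule A.

Lemma tens_lift_linear P Q (V : lmodType k) (F : P -> Q -> V) :
  balanced F -> (forall c u v, F (c *: u) v = c *: F u v) ->
  linear (tens_lift F).
Proof. by move=> Fb Fz c z w; rewrite tens_liftD // tens_liftZ. Qed.

Lemma tensor_lin_eq P Q (V : lmodType k) (f g : tensor P Q -> V) :
  linear f -> linear g -> (forall u v, f (tens u v) = g (tens u v)) -> f =1 g.
Proof. by move=> fL gL; apply: tens_eq; apply: lin_add. Qed.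

Lemma tens_linearl P Q (v : Q) : linear (fun u : P => tens u v : tensor P Q).
Proof. by move=> c u w; rewrite tensDl tensZl. Qed.
Lemma tens_linearr P Q (u : P) : linear (fun v : Q => tens u v : tensor P Q).
Proof. by move=> c v w; rewrite tensDr tensZr. Qed.

Lemma lact_tens P Q a u v : lact a (tens u v : tensor P Q) = tens (lact a u) v.
Proof. exact: tens_lactE. Qed.
Lemma ract_tens P Q u v a : ract (tens u v : tensor P Q) a = tens u (ract v a).
Proof. exact: tens_ractE. Qed.

(** The product of [f] and [g] is defined over [A] because [f] is right linear and [g] left linear.
    The left average then concerns [f] alone and the right one [g] alone. *)
Lemma tensor_trace_split P Q :
  ltrace_split x y P -> rtrace_split x y Q -> trace_split x y (tensor P Q).
Proof.
move=> [f [fL fR fP]] [g [gL gR gP]].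
pose F u v : tensor P Q := tens (f u) (g v).
have Fb : balanced F.
  split=> [u u' v|u v v'|u a v]; rewrite /F.
  - by rewrite (lin_add fL) tensDl.
  - by rewrite (lin_add gL) tensDr.
  - by rewrite fR gR tens_bal.
pose h : tensor P Q -> tensor P Q := tens_lift F.
have hL : linear h.
  by apply: tens_lift_linear => // c u v; rewrite /F (lin_scale fL) tensZl.
exists h => // z.
move: z; apply: tensor_lin_eq => // [|u v].
  exact/(ltrace_linear x y)/rtrace_linear.
rewrite -[in RHS](fP u) -[in RHS](gP v).
rewrite (lin_sum _ _ _ (tens_linearl _)) /trace /ltrace; apply: eq_bigr => i _.
rewrite /rtrace (lin_sum _ _ _ (tens_linearr _)) lact_sum; apply: eq_bigr => j _.
by rewrite lact_tens ract_tens /h tens_liftE // ract_tens lact_tens.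
Qed.

Section Splitting.
Variables (X X' X'' : bimodule A) (d' : bimod_hom X X') (d : bimod_hom X' X'').
Variables (e : X'' -> X') (e' : X' -> X).
Hypotheses (eL : linear e) (e'L : linear e').
Hypothesis eP : forall z, e (d z) + d' (e' z) = z.

(* The sum over the Casimir element makes this well defined although [g] and
   [h] are only k-linear, so k-linear contractions of a complex act on its
   tensor products. *)
Definition tens_twistr (P Y Z : bimodule A) (g : P -> P) (h : Y -> Z) : tensor P Y -> tensor P Z :=
  tens_lift (fun u v => \sum_i tens (g (ract u (x i))) (h (lact (y i) v))).

Section TwistR.
Variables (P Y Z : bimodule A) (g : P -> P) (h : Y -> Z).
Hypotheses (gL : linear g) (hL : linear h).

Fact tens_twistr_bal : @balanced _ _ P Y (tensor P Z)
  (fun u v => \sum_i tens (g (ract u (x i))) (h (lact (y i) v))).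
Proof.
have [_ _ _ xy] := xyP; split=> [u u' v|u v v'|u a v].
- rewrite -big_split; apply: eq_bigr => i _ /=.
  by rewrite ractDl (lin_add gL) tensDl.
- rewrite -big_split; apply: eq_bigr => i _ /=.
  by rewrite lactDr (lin_add hL) tensDr.
transitivity (\sum_i (tens (g (ract u (a * x i))) (h (lact (y i) v)) : tensor P Z)).
  by apply: eq_bigr => i _; rewrite ractM.
rewrite (xy (tensor P Z) (fun b c => tens (g (ract u b)) (h (lact c v)))) => [|b|b].
- by apply: eq_bigr => i _; rewrite lactM.
- by move=> c a1 a2; rewrite ract_linearr gL tensDl tensZl.
- by move=> c a1 a2; rewrite lact_linearl hL tensDr tensZr.
Qed.

Lemma tens_twistrE u v :
  tens_twistr g h (tens u v) = \sum_i tens (g (ract u (x i))) (h (lact (y i) v)).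
Proof. exact: (tens_liftE _ _ tens_twistr_bal). Qed.

Lemma tens_twistr_linear : linear (tens_twistr g h).
Proof.
apply: tens_lift_linear tens_twistr_bal _ => c u v.
rewrite scaler_sumr; apply: eq_bigr => i _.
by rewrite ractZl (lin_scale gL) tensZl.
Qed.
End TwistR.

(** The contraction of [X] is twisted by [g]. As [e d + d' e'] is the identity, what remains is the
    right average of [g], once [y i] is moved across the tensor sign. *)
Lemma tensor_splitr P : rtrace_split x y P ->
  exists (E : tensor P X'' -> tensor P X') (E' : tensor P X' -> tensor P X),
    [/\ linear E, linear E' & forall z,
      E (tensor_map (hom_id P) d z) + tensor_map (hom_id P) d' (E' z) = z].
Proof.
move=> [g [gL gR gP]]; exists (tens_twistr g e), (tens_twistr g e').
have EL := tens_twistr_linear gL eL; have E'L := tens_twistr_linear gL e'L.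
split=> //; apply: tensor_lin_eq => //.
  move=> c z w; rewrite !hom_linear EL E'L !hom_linear scalerDr.
  by rewrite addrACA.
move=> u v; rewrite tensor_mapE !tens_twistrE //.
rewrite (lin_sum _ _ _ (hom_linear (tensor_map (hom_id P) d'))) -big_split.
rewrite -[in RHS](gP u) (lin_sum _ _ _ (tens_linearl v)); apply: eq_bigr => i _.
by rewrite tensor_mapE /= -tensDr -hom_lact eP tens_bal.
Qed.

Definition tens_twistl (P Y Z : bimodule A) (g : P -> P) (h : Y -> Z) : tensor Y P -> tensor Z P :=
  tens_lift (fun u v => \sum_i tens (h (ract u (x i))) (g (lact (y i) v))).

Section TwistL.
Variables (P Y Z : bimodule A) (g : P -> P) (h : Y -> Z).
Hypotheses (gL : linear g) (hL : linear h).

Fact tens_twistl_bal : @balanced _ _ Y P (tensor Z P)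
  (fun u v => \sum_i tens (h (ract u (x i))) (g (lact (y i) v))).
Proof.
have [_ _ _ xy] := xyP; split=> [u u' v|u v v'|u a v].
- rewrite -big_split; apply: eq_bigr => i _ /=.
  by rewrite ractDl (lin_add hL) tensDl.
- rewrite -big_split; apply: eq_bigr => i _ /=.
  by rewrite lactDr (lin_add gL) tensDr.
transitivity (\sum_i (tens (h (ract u (a * x i))) (g (lact (y i) v)) : tensor Z P)).
  by apply: eq_bigr => i _; rewrite ractM.
rewrite (xy (tensor Z P) (fun b c => tens (h (ract u b)) (g (lact c v)))) => [|b|b].
- by apply: eq_bigr => i _; rewrite lactM.
- by move=> c a1 a2; rewrite ract_linearr hL tensDl tensZl.
- by move=> c a1 a2; rewrite lact_linearl gL tensDr tensZr.
Qed.

Lemma tens_twistlE u v :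
  tens_twistl g h (tens u v) = \sum_i tens (h (ract u (x i))) (g (lact (y i) v)).
Proof. exact: (tens_liftE _ _ tens_twistl_bal). Qed.

Lemma tens_twistl_linear : linear (tens_twistl g h).
Proof.
apply: tens_lift_linear tens_twistl_bal _ => c u v.
rewrite scaler_sumr; apply: eq_bigr => i _.
by rewrite ractZl (lin_scale hL) tensZl.
Qed.
End TwistL.

Lemma tensor_splitl P : ltrace_split x y P ->
  exists (E : tensor X'' P -> tensor X' P) (E' : tensor X' P -> tensor X P),
    [/\ linear E, linear E' & forall z,
      E (tensor_map d (hom_id P) z) + tensor_map d' (hom_id P) (E' z) = z].
Proof.
move=> [g [gL gR gP]]; exists (tens_twistl g e), (tens_twistl g e').
have EL := tens_twistl_linear gL eL; have E'L := tens_twistl_linear gL e'L.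
split=> //; apply: tensor_lin_eq => //.
  move=> c z w; rewrite !hom_linear EL E'L !hom_linear scalerDr.
  by rewrite addrACA.
move=> u v; rewrite tensor_mapE !tens_twistlE //.
rewrite (lin_sum _ _ _ (hom_linear (tensor_map d' (hom_id P)))) -big_split.
rewrite -[in RHS](gP v) (lin_sum _ _ _ (tens_linearr u)); apply: eq_bigr => i _.
by rewrite tensor_mapE /= -tensDl -hom_ract eP tens_bal.
Qed.

End Splitting.

End TensorSplit.

(** * Finite generation of bimodules and dimension over [k] *)

Section FiniteGeneration.
Variables (k : fieldType) (A : falgType k).

(** The generators, multiplied on both sides by vectors of a basis of [A], span [P]. *)
Lemma finitely_generated_finite_dimensional (P : bimodule A) :
  finitely_generated P -> finite_dimensional P.
Proof.
move=> [n [g gP]]; pose m := \dim {: A}; pose e := (vbasis {: A} : seq A).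
pose I := ('I_m * 'I_n * 'I_m)%type.
pose s (i : I) := ract (lact e`_i.1.1 (g i.1.2)) e`_i.2.
pose b (u : 'rV[k]_#|{: I}|) := \sum_(i : I) u 0 (enum_rank i) *: s i.
have bL : linear b.
  move=> c u v; rewrite /b scaler_sumr -big_split; apply: eq_bigr => i _ /=.
  by rewrite !mxE scalerDl scalerA.
exists #|{: I}|, b; split=> // z; have [l ->] := gP z.
elim: l => [|[[a j] a'] l [u IHl]]; first by exists 0; rewrite big_nil lin_zero.
rewrite big_cons -IHl.
exists (\row_i (coord (vbasis {: A}) (enum_val i).1.1 a
  * coord (vbasis {: A}) (enum_val i).2 a' * ((enum_val i).1.2 == j)%:R) + u).
rewrite (lin_add bL); congr (_ + _).
rewrite /= [in RHS](coord_vbasis (memvf a)) [in RHS](coord_vbasis (memvf a')).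
rewrite (lin_sum _ _ _ (lact_linearl _)) (lin_sum _ _ _ (ract_linearl _)).
rewrite /b (eq_bigr (fun i : I => (coord (vbasis {: A}) i.1.1 a
  * coord (vbasis {: A}) i.2 a' * (i.1.2 == j)%:R) *: s i)); last first.
  by move=> i _; rewrite mxE enum_rankK.
rewrite -(pair_bigA _ (fun i1 i2 => (coord (vbasis {: A}) i1.1 a
  * coord (vbasis {: A}) i2 a' * (i1.2 == j)%:R) *: s (i1, i2))) /=.
rewrite -(pair_bigA _ (fun i1 i2 => \sum_i (coord (vbasis {: A}) i1 a
  * coord (vbasis {: A}) i a' * (i2 == j)%:R) *: s (i1, i2, i))) /=.
apply: eq_bigr => i1 _; rewrite (bigD1 j) //= [X in _ + X]big1 ?addr0 => [|i2 i2j]; last first.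
  by apply: big1 => i3 _; rewrite (negPf i2j) mulr0 scale0r.
rewrite (lin_sum _ _ _ (ract_linearr _)); apply: eq_bigr => i2 _.
by rewrite eqxx mulr1 -scalerA lactZl ractZl ractZr.
Qed.

End FiniteGeneration.

(** * Unit isomorphisms of the tensor product over [A] *)

Section Unitors.
Variables (k : fieldType) (A : falgType k) (M : bimodule A).
Local Notation regA := (regular_bimodule A).

Definition tensor_actl_fun : tensor regA M -> M :=
  tens_lift (fun (a : regA) (u : M) => lact (a : A) u).

Fact tensor_actl_bal : @balanced _ _ regA M M (fun a u => lact (a : A) u).
Proof.
split=> [a b u|a u v|a b u] /=; first exact: lactDl.
  exact: lactDr.
exact: lactM.
Qed.
Fact tensor_actl_funE (a : regA) u : tensor_actl_fun (tens a u) = lact (a : A) u.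
Proof. exact: (tens_liftE _ _ tensor_actl_bal). Qed.
Fact tensor_actl_linear : linear tensor_actl_fun.
Proof. by apply: tens_lift_linear tensor_actl_bal _ => c a u; rewrite lactZl. Qed.
Fact tensor_actl_lact a z : tensor_actl_fun (lact a z) = lact a (tensor_actl_fun z).
Proof.
move: z; apply: tensor_lin_eq => [||b u].
- exact: lin_comp tensor_actl_linear (lact_linearr a).
- exact: lin_comp (lact_linearr a) tensor_actl_linear.
- by rewrite lact_tens !tensor_actl_funE /= lactM.
Qed.
Fact tensor_actl_ract z a : tensor_actl_fun (ract z a) = ract (tensor_actl_fun z) a.
Proof.
move: z; apply: tensor_lin_eq => [||b u].
- exact: (lin_comp tensor_actl_linear (ract_linearl a)).
- exact: (lin_comp (ract_linearl a) tensor_actl_linear).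
- by rewrite ract_tens !tensor_actl_funE lractA.
Qed.

Definition tensor_actl : bimod_hom (tensor regA M) M :=
  BimodHom tensor_actl_linear tensor_actl_lact tensor_actl_ract.

Lemma tensor_actlE (a : regA) u : tensor_actl (tens a u) = lact (a : A) u.
Proof. exact: tensor_actl_funE. Qed.

Lemma tensor_actlK : cancel tensor_actl (tens ((1 : A) : regA)).
Proof.
apply: tensor_lin_eq => // [|a u].
  exact: (lin_comp (tens_linearr ((1 : A) : regA)) (hom_linear tensor_actl)).
by rewrite tensor_actlE -tens_bal /= mul1r.
Qed.

Definition tensor_actr_fun : tensor M regA -> M :=
  tens_lift (fun (u : M) (a : regA) => ract u (a : A)).

Fact tensor_actr_bal : @balanced _ _ M regA M (fun u a => ract u (a : A)).
Proof.
split=> [a b u|a u v|a b u] /=; first exact: ractDl.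
  exact: ractDr.
by rewrite ractM.
Qed.
Fact tensor_actr_funE u (a : regA) : tensor_actr_fun (tens u a) = ract u (a : A).
Proof. exact: (tens_liftE _ _ tensor_actr_bal). Qed.
Fact tensor_actr_linear : linear tensor_actr_fun.
Proof. by apply: tens_lift_linear tensor_actr_bal _ => c a u; rewrite ractZl. Qed.
Fact tensor_actr_lact a z : tensor_actr_fun (lact a z) = lact a (tensor_actr_fun z).
Proof.
move: z; apply: tensor_lin_eq => [||b u].
- exact: lin_comp tensor_actr_linear (lact_linearr a).
- exact: lin_comp (lact_linearr a) tensor_actr_linear.
- by rewrite lact_tens !tensor_actr_funE lractA.
Qed.
Fact tensor_actr_ract z a : tensor_actr_fun (ract z a) = ract (tensor_actr_fun z) a.
Proof.
move: z; apply: tensor_lin_eq => [||b u].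
- exact: (lin_comp tensor_actr_linear (ract_linearl a)).
- exact: (lin_comp (ract_linearl a) tensor_actr_linear).
- by rewrite ract_tens !tensor_actr_funE /= ractM.
Qed.

Definition tensor_actr : bimod_hom (tensor M regA) M :=
  BimodHom tensor_actr_linear tensor_actr_lact tensor_actr_ract.

Lemma tensor_actrE u (a : regA) : tensor_actr (tens u a) = ract u (a : A).
Proof. exact: tensor_actr_funE. Qed.

Lemma tensor_actrK : cancel tensor_actr (fun u => tens u ((1 : A) : regA)).
Proof.
apply: tensor_lin_eq => // [|u a].
  exact: (lin_comp (tens_linearl ((1 : A) : regA)) (hom_linear tensor_actr)).
by rewrite tensor_actrE tens_bal /= mulr1.
Qed.

End Unitors.

(** * Rows and columns of tensor products, and contractions over [k] *)

Section RowsColumns.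
Variables (k : fieldType) (A : falgType k) (Q : bimodule A) (C : complex A).

Fact tensor_row_diffK (i j l : int) (Hij : i = j + 1) (Hjl : j = l + 1) z :
  tensor_map (hom_id Q) (diff C Hjl) (tensor_map (hom_id Q) (diff C Hij) z) = 0.
Proof. by rewrite tensor_map_comp diff_comp0 tensor_map0r. Qed.
Definition tensor_row : complex A :=
  @Complex k A (fun q => tensor Q (C q))
    (fun i j H => tensor_map (hom_id Q) (diff C H)) tensor_row_diffK.

Fact tensor_col_diffK (i j l : int) (Hij : i = j + 1) (Hjl : j = l + 1) z :
  tensor_map (diff C Hjl) (hom_id Q) (tensor_map (diff C Hij) (hom_id Q) z) = 0.
Proof. by rewrite tensor_map_comp diff_comp0 tensor_map0l. Qed.
Definition tensor_col : complex A :=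
  @Complex k A (fun p => tensor (C p) Q)
    (fun i j H => tensor_map (diff C H) (hom_id Q)) tensor_col_diffK.

End RowsColumns.

Section SplitComplexes.
Variables (k : fieldType) (A : falgType k).
Variables (n : nat) (x y : 'I_n -> A) (t : A -> k^o).
Hypothesis xyP : casimir x y t.

(** Contractibility over [k], one degree at a time: the pairs in neighbouring degrees need not fit
    together, as each lift or extension uses a single one. *)
Definition split_complex (C : complex A) :=
  forall (i j l : int) (Hij : i = j + 1) (Hjl : j = l + 1),
  exists (e : C l -> C j) (e' : C j -> C i),
    [/\ linear e, linear e' & forall z, e (diff C Hjl z) + diff C Hij (e' z) = z].

Lemma complete_resolution_split (T : complete_resolution A) : split_complex T.
Proof.
move=> i j l Hij Hjl.
apply: split_exact; try exact: finitely_generated_finite_dimensional (cr_fg T _).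
- exact: hom_linear.
- exact: hom_linear.
- exact: cr_acyclic.
Qed.

Lemma tensor_row_split (Q : bimodule A) (C : complex A) :
  rtrace_split x y Q -> split_complex C -> split_complex (tensor_row Q C).
Proof.
move=> Qs Cs i j l Hij Hjl; have [e [e' [eL e'L eP]]] := Cs i j l Hij Hjl.
exact: (tensor_splitr xyP eL e'L eP Qs).
Qed.

Lemma tensor_col_split (Q : bimodule A) (C : complex A) :
  ltrace_split x y Q -> split_complex C -> split_complex (tensor_col Q C).
Proof.
move=> Qs Cs i j l Hij Hjl; have [e [e' [eL e'L eP]]] := Cs i j l Hij Hjl.
exact: (tensor_splitl xyP eL e'L eP Qs).
Qed.

(** On cycles [e'] is a linear section of the differential; the trace makes the lift a bimodule
    map. *)
Lemma split_cycles_lift (P : bimodule A) (C : complex A) :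
  trace_split x y P -> split_complex C -> cycles_lift P C.
Proof.
move=> Ps Cs i j H f f0.
have H' : j = j - 1 + 1 by rewrite subrK.
have [e [e' [eL e'L eP]]] := Cs _ _ _ H H'.
apply: (trace_lift xyP (e := e')) => // m.
by rewrite -[RHS](eP (f m)) f0 (lin_zero eL) add0r.
Qed.

(** As [f] kills boundaries, [f e] is a linear extension, again corrected by the trace. *)
Lemma split_cocycles_extend (C : complex A) (Q : bimodule A) :
  trace_split x y Q -> split_complex C -> cocycles_extend C Q.
Proof.
move=> Qs Cs i j H f f0.
have [e [e' [eL e'L eP]]] := Cs _ _ _ erefl H.
apply: (trace_extend xyP (e := e)) => // m.
by rewrite -[in RHS](eP m) homD f0 addr0.
Qed.

End SplitComplexes.

(** * The two diagonal maps are homotopic *)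

Section Homotopy.
Variables (k : fieldType) (A : falgType k).
Variables (n0 : nat) (x0 y0 : 'I_n0 -> A) (t0 : A -> k^o).
Hypothesis xyP : casimir x0 y0 t0.
Variables T X : complete_resolution A.

Local Notation eps := (cr_aug X).

(** The coaugmentation is injective and composes with [eps] to a differential. *)
Lemma aug_diff (H : 1 = 0 + 1 :> int) x : eps (diff X H x) = 0.
Proof.
apply: (@cr_coaug_inj _ _ X); rewrite hom0 -(cr_factor (erefl : 0 = -1 + 1 :> int)).
exact: diffK.
Qed.

Section Degree.
Variables (p p' q q' : int) (Hp : p' = p + 1) (Hq : q' = q + 1).

(** The partial differentials carry no Koszul sign, so they commute; the factor (-1)^p is written
    out where they are added. *)
Definition hdiff r : bimod_hom (tensor (X p') (X r)) (tensor (X p) (X r)) :=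
  tensor_map (diff X Hp) (hom_id (X r)).
Definition vdiff r : bimod_hom (tensor (X r) (X q')) (tensor (X r) (X q)) :=
  tensor_map (hom_id (X r)) (diff X Hq).

Lemma hdiff_vdiff z : hdiff q (vdiff p' z) = vdiff p (hdiff q' z).
Proof. by rewrite !tensor_map_comp !hom_comp1l !hom_comp1r. Qed.

End Degree.

Lemma hdiff_hdiff p p' p'' (Hp : p' = p + 1) (Hp' : p'' = p' + 1) q z :
  hdiff Hp q (hdiff Hp' q z) = 0.
Proof. by rewrite tensor_map_comp diff_comp0 tensor_map0l. Qed.
Lemma vdiff_vdiff q q' q'' (Hq : q' = q + 1) (Hq' : q'' = q' + 1) p z :
  vdiff Hq p (vdiff Hq' p z) = 0.
Proof. by rewrite tensor_map_comp diff_comp0 tensor_map0r. Qed.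

Definition augl q : bimod_hom (tensor (X 0) (X q)) (X q) :=
  hom_comp (tensor_actl (X q)) (tensor_map eps (hom_id (X q))).
Definition augr p : bimod_hom (tensor (X p) (X 0)) (X p) :=
  hom_comp (tensor_actr (X p)) (tensor_map (hom_id (X p)) eps).

Lemma augl_hdiff (H : 1 = 0 + 1 :> int) q z : augl q (hdiff H q z) = 0.
Proof.
rewrite /augl; cbn [hom_comp hom_fun]; rewrite tensor_map_comp.
rewrite (_ : hom_comp _ (diff X H) = 0) ?tensor_map0l ?hom0 //.
by apply: hom_ext => u; apply: aug_diff.
Qed.

Lemma augr_vdiff (H : 1 = 0 + 1 :> int) p z : augr p (vdiff H p z) = 0.
Proof.
rewrite /augr; cbn [hom_comp hom_fun]; rewrite tensor_map_comp.
rewrite (_ : hom_comp _ (diff X H) = 0) ?tensor_map0r ?hom0 //.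
by apply: hom_ext => u; apply: aug_diff.
Qed.

Lemma augl_vdiff q q' (H : q' = q + 1) z : augl q (vdiff H 0 z) = diff X H (augl q' z).
Proof.
move: z; apply: tensor_lin_eq => [||u v].
- exact: (hom_linear (hom_comp (augl q) (vdiff H 0))).
- exact: (hom_linear (hom_comp (diff X H) (augl q'))).
rewrite /augl /vdiff; cbn [hom_comp hom_fun].
by rewrite !tensor_mapE !tensor_actlE hom_lact.
Qed.

(** The differential leaving degree 0 factors through [eps], and the unit isomorphism in [augl]
    loses nothing. *)
Lemma augl_eq0 q z p (H : 0 = p + 1) : augl q z = 0 -> hdiff H q z = 0.
Proof.
have pE : p = -1 by apply: (addIr 1); rewrite -H.
subst p => z0; have : tensor_map eps (hom_id (X q)) z = 0.
  by rewrite -[LHS]tensor_actlK [tensor_actl _ _]z0 (lin_zero (tens_linearr _)).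
move=> {}z0; rewrite /hdiff.
rewrite (_ : diff X H = hom_comp (cr_coaug X) eps); last first.
  by apply: hom_ext => u; apply: cr_factor.
by rewrite -[hom_id _](hom_comp1l (hom_id _)) -tensor_map_comp z0 hom0.
Qed.

Lemma augr_eq0 p z q (H : 0 = q + 1) : augr p z = 0 -> vdiff H p z = 0.
Proof.
have qE : q = -1 by apply: (addIr 1); rewrite -H.
subst q => z0; have : tensor_map (hom_id (X p)) eps z = 0.
  by rewrite -[LHS]tensor_actrK [tensor_actr _ _]z0 (lin_zero (tens_linearl _)).
move=> {}z0; rewrite /vdiff.
rewrite (_ : diff X H = hom_comp (cr_coaug X) eps); last first.
  by apply: hom_ext => u; apply: cr_factor.
by rewrite -[hom_id _](hom_comp1l (hom_id _)) -tensor_map_comp z0 hom0.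
Qed.

Lemma augl_surj q u : exists z, augl q z = u.
Proof.
have [e eE] := cr_aug_surj X 1; exists (tens e u).
by rewrite /augl; cbn [hom_comp hom_fun]; rewrite tensor_mapE tensor_actlE eE lact1.
Qed.

Lemma augr_surj p u : exists z, augr p z = u.
Proof.
have [e eE] := cr_aug_surj X 1; exists (tens u e).
by rewrite /augr; cbn [hom_comp hom_fun]; rewrite tensor_mapE tensor_actrE eE ract1.
Qed.

(** Brings the normalisation of a diagonal approximation into the form needed on row 0. *)
Lemma aug_augl z : eps (augl 0 z) = tensor_mul A (tensor_map eps eps z).
Proof.
move: z; apply: tensor_lin_eq => [||u v].
- exact: (hom_linear (hom_comp eps (augl 0))).
- exact: (hom_linear (hom_comp (tensor_mul A) (tensor_map eps eps))).
rewrite /augl; cbn [hom_comp hom_fun].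
by rewrite !tensor_mapE tensor_actlE tensor_mulE hom_lact.
Qed.

Lemma cr_trace_split p (S : complete_resolution A) : trace_split x0 y0 (S p).
Proof. exact: (projective_trace_split xyP (@cr_proj _ _ S p)). Qed.
Lemma cr_ltrace_split p : ltrace_split x0 y0 (X p).
Proof. exact: (projective_ltrace_split xyP (@cr_proj _ _ X p)). Qed.
Lemma cr_rtrace_split p : rtrace_split x0 y0 (X p).
Proof. exact: (projective_rtrace_split xyP (@cr_proj _ _ X p)). Qed.

(** Rows split, so only a start for [null_homotopy] is missing. In vertical degree 0, [augr g] kills
    boundaries and extends along the differential of [T]; the extension lifts through [augr], and
    [augr_eq0] concludes. The scalar [c] stands for the sign of the row. *)
Lemma row_null_homotopy (p : int) (c : k)
    (g : forall n q : int, bimod_hom (T n) (tensor (X p) (X q))) :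
  c != 0 ->
  (forall n m q' q (Hn : n = m + 1) (Hq : q' = q + 1), n = p + q' ->
     forall x, g m q (diff T Hn x) = c *: vdiff Hq p (g n q' x)) ->
  exists s : forall n q, bimod_hom (T n) (tensor (X p) (X q)),
    forall n m q q' (Hn : n = m + 1) (Hq : q' = q + 1), n = p + q ->
    forall x, g n q x = c *: vdiff Hq p (s n q' x) + s m q (diff T Hn x).
Proof.
move=> c0 gd.
apply: (@null_homotopy k A T (tensor_row (X p) X) p c g) => //.
- move=> n; apply: (split_cycles_lift xyP (cr_trace_split n T)).
  exact: (tensor_row_split xyP (cr_rtrace_split p) (complete_resolution_split X)).
- move=> q; apply: (split_cocycles_extend xyP); last exact: complete_resolution_split.
  exact: (tensor_trace_split (cr_ltrace_split p) (cr_rtrace_split q)).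
have Hn : p = p - 1 + 1 by rewrite subrK.
have Hq : 0 = -1 + 1 :> int by [].
have [l H x|v vP] := split_cocycles_extend xyP (cr_trace_split p X)
    (complete_resolution_split T) Hn (f := hom_comp (augr p) (g p 0)).
  have H1 : 1 = 0 + 1 :> int by [].
  by cbn [hom_comp hom_fun]; rewrite (gd _ _ _ _ H H1) // homZ augr_vdiff scaler0.
have [w wP] := cr_proj v (@augr_surj p).
exists p, (p - 1), 0, (-1), Hn, Hq, w; split=> [|x]; first by rewrite addr0.
apply/eqP; rewrite -subr_eq0 -homB; apply/eqP/augr_eq0.
rewrite homB -[augr p (w _)]/(hom_comp (augr p) w _) wP vP.
exact: subrr.
Qed.

(* [p] and [q] are the horizontal and the vertical degree; the rows to the
   right of [0] are killed by lifting and those to the left by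
   contractibility. *)
Lemma diagonal_null_homotopy
    (h : forall n p q : int, bimod_hom (T n) (tensor (X p) (X q))) :
  (forall n m p q p' q' (Hn : n = m + 1) (Hp : p' = p + 1) (Hq : q' = q + 1),
     m = p + q -> forall x,
     h m p q (diff T Hn x)
     = hdiff Hp q (h n p' q x) + (-1) ^ p *: vdiff Hq p (h n p q' x)) ->
  (forall x, tensor_mul A (tensor_map eps eps (h 0 0 0 x)) = 0) ->
  exists s : forall n p q, bimod_hom (T n) (tensor (X p) (X q)),
    forall n m p q p' q' (Hn : n = m + 1) (Hp : p' = p + 1) (Hq : q' = q + 1),
    n = p + q -> forall x,
    h n p q x = hdiff Hp q (s n p' q x) + (-1) ^ p *: vdiff Hq p (s n p q' x)
                + s m p q (diff T Hn x).
Proof.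
move=> hd h0.
pose W p := forall n q, bimod_hom (T n) (tensor (X p) (X q)).
(* [r p] is the share of row [p] of the homotopy in the equation in row [p]. [J] says that [h - r]
   is a horizontal cycle, and [R] is the full equation, whose other term comes from the next row. *)
pose r p n m q q' (Hn : n = m + 1) (Hq : q' = q + 1) (w : W p) (x : T n) :=
  (-1) ^ p *: vdiff Hq p (w n q' x) + w m q (diff T Hn x).
pose J p (w : W p) := forall n m p0 q q' (Hn : n = m + 1) (Hp : p = p0 + 1)
  (Hq : q' = q + 1), n = p + q -> forall x,
  hdiff Hp q (h n p q x) = hdiff Hp q (r p n m q q' Hn Hq w x).
pose R p p' (w : W p) (w' : W p') := forall n m q q' (Hn : n = m + 1)
  (Hp : p' = p + 1) (Hq : q' = q + 1), n = p + q -> forall x,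
  h n p q x = hdiff Hp q (w' n q x) + r p n m q q' Hn Hq w x.
have H10 : 1 = 0 + 1 :> int by [].
have signS (p p' : int) : p' = p + 1 -> (-1) ^ p' = - (-1) ^ p :> k.
  by move=> ->; rewrite expfzDr ?oppr_eq0 ?oner_eq0 // expr1z mulrN1.
have [|p p' w pp' Jw|l p w pl Jw|s sR] := int_chain (J := J) (R := R).
(* Row 0: [augl h] is a chain map from [T] to [X]. It vanishes after the augmentation, so its
   null-homotopy can start from the zero map. *)
- have [|n|q|n m q l Hn Hq nE x||sg sgP] := @null_homotopy k A T X 0 1
      (fun n q => hom_comp (augl q) (h n 0 q)).
  + exact: oner_neq0.
  + exact: (split_cycles_lift xyP (cr_trace_split n T) (complete_resolution_split X)).
  + exact: (split_cocycles_extend xyP (cr_trace_split q X) (complete_resolution_split T)).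
  + have mE : m = 0 + l by apply: (addIr 1); rewrite -Hn nE Hq addrA.
    cbn [hom_comp hom_fun].
    by rewrite (hd n m 0 l 1 q Hn H10 Hq) // homD homZ augl_hdiff augl_vdiff add0r expr0z.
  + have H0 : 0 = -1 + 1 :> int by [].
    exists 0, (-1), 0, (-1), H0, H0, 0; split=> // x.
    by rewrite cr_factor [eps _]aug_augl h0 !hom0.
  exists 0.
  (* The null-homotopy lifts through [augl] by projectivity; equality after [augl] suffices for
     [J]. *)
  have /dependent_choice[w wP] n : exists w : forall q, bimod_hom (T n) (tensor (X 0) (X q)),
      forall q, hom_comp (augl q) (w q) = sg n q.
    have /dependent_choice[w wP] q := cr_proj (sg n q) (@augl_surj q).
    by exists w.
  have {}wP n q x : augl q (w n q x) = sg n q x by rewrite -wP.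
  exists w => n m p0 q q' Hn Hp Hq nE x.
  apply/eqP; rewrite -subr_eq0 -homB; apply/eqP/augl_eq0.
  rewrite homB /r homD homZ augl_vdiff !wP expr0z -(sgP n m q q' Hn Hq) //.
  by rewrite subrr.
(* Rows to the right: the horizontal cycle [h - r] lifts along the column, which splits. *)
- have /dependent_choice[w' w'P] n :
      exists w' : forall q, bimod_hom (T n) (tensor (X p') (X q)),
      forall q m q' (Hn : n = m + 1) (Hq : q' = q + 1), n = p + q ->
      forall x, hdiff pp' q (w' q x) = h n p q x - r p n m q q' Hn Hq w x.
    suff /dependent_choice[w' w'P] q : exists w' : bimod_hom (T n) (tensor (X p') (X q)),
      forall m q' (Hn : n = m + 1) (Hq : q' = q + 1), n = p + q ->
      forall x, hdiff pp' q (w' x) = h n p q x - r p n m q q' Hn Hq w x by exists w'.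
    have [nE|nN] := pselect (n = p + q); last by exists 0.
    have nm : n = n - 1 + 1 by rewrite subrK.
    have [l Hl x|w' w'P] := split_cycles_lift xyP (cr_trace_split n T)
      (tensor_col_split xyP (cr_ltrace_split q) (complete_resolution_split X)) pp'
      (f := h n p q - ((-1) ^ p *: hom_comp (vdiff erefl p) (w n (q + 1))
                       + hom_comp (w (n - 1) q) (diff T nm))).
      rewrite hom_subE homB; apply/eqP; rewrite subr_eq0; apply/eqP.
      exact: Jw.
    exists w' => m q' Hn Hq _ x; rewrite [LHS]w'P hom_subE; congr (_ - _).
    have mE : n - 1 = m by rewrite Hn addrK.
    by subst q' m; rewrite (Prop_irrelevance nm Hn).
  exists w'; split=> [n m p0 q q' Hn Hp Hq nE x|n m q q' Hn Hp Hq nE x]; last first.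
    by rewrite (Prop_irrelevance Hp pp') (w'P n q m q' Hn Hq) // subrK.
  have pE : p0 = p by apply: (addIr 1); rewrite -Hp -pp'.
  subst p0; rewrite (Prop_irrelevance Hp pp').
  have mE : m = p + q by apply: (addIr 1); rewrite -Hn nE pp' addrAC.
  have nE' : n = p + q' by rewrite nE pp' Hq -addrA [1 + q]addrC.
  have Hm : m = m - 1 + 1 by rewrite subrK.
  (* [J] passes to row [p']: repeated differentials vanish, and the vertical terms cancel because
     the sign changes between the two rows. *)
  rewrite /r homD homZ hdiff_vdiff (w'P n q' m (q' + 1) Hn erefl) //.
  rewrite (w'P m q (m - 1) q' Hm Hq) // (hd n m p q p' q' Hn pp' Hq) //.
  rewrite /r diffK hom0 addr0 homB homD homZ vdiff_vdiff scaler0 add0r.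
  rewrite (signS p p') // scaleNr scalerBr.
  by rewrite -[_ + _ - _]addrA [RHS]addrCA addNr addr0.
(* Rows to the left: by [hd] and [J], [h - hdiff w] commutes with the differentials up to the sign
   of row [l], so it is null-homotopic. [J] persists because [hdiff] applied twice is zero. *)
- have [||s sP] := @row_null_homotopy l ((-1) ^ l)
      (fun n q => h n l q - hom_comp (hdiff pl q) (w n q)).
  + by rewrite expfz_neq0 // oppr_eq0 oner_eq0.
  + move=> n m q' q Hn Hq nE x.
    have mE : m = l + q by apply: (addIr 1); rewrite -Hn nE Hq addrA.
    have nE' : n = p + q by rewrite nE pl Hq -addrA [1 + q]addrC.
    rewrite !hom_subE; cbn [hom_comp hom_fun].
    rewrite (hd n m l q p q' Hn pl Hq) // (Jw n m l q q' Hn pl Hq) //.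
    rewrite /r homB [hdiff pl q (_ + _)]homD homZ hdiff_vdiff (signS l p) // scalerBr scaleNr.
    by rewrite addrAC addrK addrC.
  exists (fun n q => s n q); split=> [n m p0 q q' Hn Hp Hq nE x|n m q q' Hn Hp Hq nE x].
    by rewrite /r -sP // hom_subE homB hdiff_hdiff subr0.
  by rewrite (Prop_irrelevance Hp pl) /r -sP // hom_subE addrC subrK.
exists (fun n p q => s p n q) => n m p q p' q' Hn Hp Hq nE x.
by rewrite -addrA; apply: (sR p p').
Qed.

End Homotopy.

Lemma cocycle_diff (k : fieldType) (A : falgType k) (C : complex A)
    (M : bimodule A) (n m : int) (u : cocycle C M n) (H : m = n + 1) :
  hom_comp u (diff C H) = 0.
Proof.
have c0 : - (-1) ^ n != 0 :> k.
  by rewrite oppr_eq0 expfz_neq0 // oppr_eq0 oner_eq0.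
apply: hom_ext => z; apply: (scalerI c0).
by rewrite hom0E scaler0 -[LHS]/(codiff H u z) cocycleE.
Qed.

(** * Comparison of two diagonal approximations *)

Section Comparison.
Variables (k : fieldType) (A : falgType k) (T X : complete_resolution A).
Variables (Delta : diagonal_approximation T) (Delta' : diagonal_approximation X).
Variable f : augmented_chain_map T X.

(** The components of Delta' f - (f (x) f) Delta. The value 0 off the line [p + q = n] allows all
    triples of degrees as indices. *)
Definition diag_gap (n p q : int) : bimod_hom (T n) (tensor (X p) (X q)) :=
  match pselect (p + q = n) with
  | left H =>
    hom_comp (dprod_proj (fun pq : bidegree n => tensor (X (deg1 pq)) (X (deg2 pq)))
      (Bidegree H)) (hom_comp (Delta' n) (f n))
    - hom_comp (tensor_map (f p) (f q)) (hom_comp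
      (dprod_proj (fun pq : bidegree n => tensor (T (deg1 pq)) (T (deg2 pq)))
        (Bidegree H)) (Delta n))
  | right _ => 0
  end.

Lemma diag_gapE n p q (H : p + q = n) x :
  diag_gap n p q x = Delta' n (f n x) (Bidegree H)
                     - tensor_map (f p) (f q) (Delta n x (Bidegree H)).
Proof.
rewrite /diag_gap; case: pselect => [H'|//]; rewrite (Prop_irrelevance H' H).
exact: hom_subE.
Qed.

Lemma diag_gap_diff n m p q p' q' (Hn : n = m + 1) (Hp : p' = p + 1)
    (Hq : q' = q + 1) : m = p + q -> forall x,
  diag_gap m p q (diff T Hn x)
  = hdiff X Hp q (diag_gap n p' q x) + (-1) ^ p *: vdiff X Hq p (diag_gap n p q' x).
Proof.
move=> mE x; have H := esym mE.
have Hl : p' + q = n by rewrite Hn mE Hp addrAC.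
have Hr : p + q' = n by rewrite Hn mE Hq addrA.
rewrite (diag_gapE H) (diag_gapE Hl) (diag_gapE Hr) !chain_mapP.
subst p' q'.
rewrite -![diff (ctens _ _) Hn _]/(ctens_diff_fun Hn _) !ctens_diff_funE; cbn [deg1 deg2].
rewrite (Prop_irrelevance (bidegree_succl Hn (Bidegree H)) Hl).
rewrite (Prop_irrelevance (bidegree_succr Hn (Bidegree H)) Hr).
rewrite homD homZ !homB /hdiff /vdiff !tensor_map_comp !hom_comp1l !hom_comp1r.
have fd i j (E : i = j + 1) :
    hom_comp (f j) (diff T E) = hom_comp (diff X E) (f i).
  by apply: hom_ext => z; apply: chain_mapP.
by rewrite !fd scalerBr opprD addrACA.
Qed.

(** The diagonal approximations and [f] preserve the augmentation, so both terms have value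
    [cr_aug T x]. *)
Lemma diag_gap_aug x :
  tensor_mul A (tensor_map (cr_aug X) (cr_aug X) (diag_gap 0 0 0 x)) = 0.
Proof.
rewrite (diag_gapE (addr0 0)) !homB tensor_map_comp.
have fa : hom_comp (cr_aug X) (f 0) = cr_aug T.
  by apply: hom_ext => z; apply: acm_aug.
have augE (S : complete_resolution A) (D : diagonal_approximation S) z :
    tensor_mul A (tensor_map (cr_aug S) (cr_aug S) (D 0 z (Bidegree (addr0 0)))) = cr_aug S z.
  by rewrite -(diag_aug D) /ctens_map homZE mulr0 expr0z scale1r.
rewrite fa !augE acm_aug.
exact: subrr.
Qed.

End Comparison.

(** The map [cohomology_map f] is the canonical identification. Two diagonal approximations on one
    resolution are the case where [f] is the identity. *)
Theorem corollary3p10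
  (k : fieldType) (A : falgType k) (frobA : Frobenius A)
  (M N : bimodule A) (r s : int)
  (T T' : complete_resolution A)
  (Delta : diagonal_approximation T) (Delta' : diagonal_approximation T')
  (f : augmented_chain_map T T')
  (a : cohomology T' M r) (b : cohomology T' N s) :
  cohomology_map f (cup Delta' a b)
  = cup Delta (cohomology_map f a) (cohomology_map f b).
Proof.
have [n [x [y [t xyP]]]] := Frobenius_casimir frobA.
have [w wP] := diagonal_null_homotopy xyP (@diag_gap_diff k A T T' Delta Delta' f)
  (@diag_gap_aug k A T T' Delta Delta' f).
rewrite -(coreprK a) -(coreprK b); move: (corepr a) (corepr b) => u v.
rewrite cupE !cohomology_mapE cupE; apply/coclassP/asboolP.
pose m := r + s - 1; have H : r + s = m + 1 by rewrite subrK.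
have c0 : - (-1) ^ m != 0 :> k.
  by rewrite oppr_eq0 expfz_neq0 // oppr_eq0 oner_eq0.
(* This is the component [(r, s)] of the homotopy followed by [u (x) v] with its Koszul sign; the
   inverse factor cancels the sign in [codiff]. *)
exists m, H, (((- (-1) ^ m)^-1 * (-1) ^ (r * s)) *: hom_comp (tensor_map u v) (w m r s)).
apply: hom_ext => z; rewrite /codiff homZE.
transitivity ((-1) ^ (r * s) *: tensor_map u v (w m r s (diff T H z))).
  by cbn [hom_comp hom_fun]; rewrite homZE scalerA mulrA divff // mul1r.
have := wP (r + s) m r s _ _ H erefl erefl erefl z.
rewrite (diag_gapE _ _ _ (erefl (r + s))) => wE.
transitivity ((-1) ^ (r * s) *: tensor_map u v (Delta' (r + s) (f (r + s) z) (Bidegree erefl)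
   - tensor_map (f r) (f s) (Delta (r + s) z (Bidegree erefl)))).
  (* The [hdiff] and [vdiff] terms die because [u] and [v] are cocycles. *)
  congr (_ *: _); rewrite wE !homD homZ /hdiff /vdiff !tensor_map_comp !cocycle_diff.
  by rewrite tensor_map0l tensor_map0r scaler0 !add0r.
by rewrite homB tensor_map_comp scalerBr; apply/esym/hom_subE.
Qed.
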